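(* Let $\hat{\varphi}$ be a (nowhere vanishing) pure spinor field on $(M,g)$, $\dim M=2n$. If the maximally isotropic distribution generated by $\hat{\varphi}$ is integrable, then one can always choose the $1$-form $A$ (i.e. the spinorial connection $\hat\nabla$) so that $\hat{\boldsymbol{T}}_X \hat{\varphi}= 0$ for all vector fields $X$ tangent to this distribution. Conversely, if the dimension $2n$ is different from six and, for a spinorial connection $\hat\nabla$, $\hat{\boldsymbol{T}}_X \hat{\varphi}= 0$ for all vector fields $X$ tangent to the maximally isotropic distribution generated by $\hat{\varphi}$, then this distribution is integrable.
   Context: $(M,g)$ is a smooth $2n$-dimensional manifold with a non-degenerate metric $g$ of arbitrary signature; $\nabla$ is its Levi-Civita connection. Vector fields are sections of the complexified tangent bundle, and $g$, $\nabla$ and the Lie bracket are extended complex-linearly. All results are local: $M$ is replaced by a small open set on which there is a frame $\{e_i,\theta^j\}_{i,j=1}^n$ of the complexified tangent bundle with $g(e_i,e_j)=0$, $g(\theta^i,\theta^j)=0$, $g(e_i,\theta^j)=\frac12\delta_i^j$. Let $V=\mathrm{Span}\{e_i\}$, and identify $\mathrm{Span}\{\theta^j\}$ with the dual bundle $V^*$ via $\theta^j(e_i)=\delta^j_i$. The spinor bundle is $S=\wedge V^*$ with Clifford action $(e+\theta)\cdot\hat\varphi=e\lrcorner\hat\varphi+\theta\wedge\hat\varphi$ for $e\in V,\theta\in V^*$; thus $(vu+uv)\cdot\hat\varphi=2g(v,u)\hat\varphi$. A spinorial connection is a connection $\hat\nabla$ on $S$ satisfying the Leibniz rule $\hat\nabla_X(v\cdot\hat\varphi)=(\nabla_Xv)\cdot\hat\varphi+v\cdot\hat\nabla_X\hat\varphi$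 for all vector fields $X,v$ and spinor fields $\hat\varphi$. Write $e_{i+n}=\theta^i$, so $\{e_a\}_{a=1}^{2n}$ is the frame; $g_{ab}=g(e_a,e_b)$ with inverse $g^{ab}$; $\nabla_{e_a}e_b=\omega_{ab}{}^{c}e_c$ and $\omega_a{}^{dc}=g^{bd}\omega_{ab}{}^{c}$. In the spinor frame $\{\hat\psi_\alpha\}$ given by wedge products of the $\theta^i$, the spinorial connections are exactly those given by $\hat\nabla_{e_a}\hat\psi_\alpha=-\frac14\omega_a{}^{bc}\,e_b\cdot(e_c\cdot\hat\psi_\alpha)+A_a\hat\psi_\alpha$ with $A$ an arbitrary (complex-valued) $1$-form; choosing $A$ means choosing $\hat\nabla$. The Dirac operator is $\hat{\boldsymbol D}=g^{ab}e_a\cdot\hat\nabla_{e_b}$ and the twistor operator is $\hat{\boldsymbol T}_X\hat\psi=\hat\nabla_X\hat\psi-\frac1{2n}X\cdot\hat{\boldsymbol D}\hat\psi$. A nowhere vanishing spinor field $\hat\varphi$ is pure if at each point the (necessarily isotropic) space $N_{\hat\varphi}=\{v: v\cdot\hat\varphi=0\}$ of complexified tangent vectors has the maximal possible dimension $n$; $N_{\hat\varphi}$ is then the maximally isotropic distribution generated by $\hat\varphi$. A distribution is integrable if it is closed under Lie brackets. *)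

(* Defs.v *)
From HB Require Import structures.
From mathcomp Require Import all_boot all_order all_algebra.
From mathcomp Require Import all_classical all_reals all_analysis.
From mathcomp Require Import complex.

Set Implicit Arguments.
Unset Strict Implicit.
Unset Printing Implicit Defensive.

Import Order.TTheory GRing.Theory Num.Theory.
Import numFieldNormedType.Exports.

Local Open Scope classical_set_scope.
Local Open Scope ring_scope.

(* The manifold is an open subset U of R^m (a coordinate chart).  Fields on U
   are total functions on R^m; only their values on U are ever constrained or
   used. *)
Notation coords R m := 'rV[R]_m (only parsing).
(* Sections of the complexified tangent bundle, by coordinate components. *)
Notation vfield R m := (coords R m -> 'rV[R[i]]_m) (only parsing).
Notation metric_field R m := (coords R m -> 'M[R]_m) (only parsing).

Section Calculus.
Variables (R : realType) (m : nat).
Implicit Types (U : set (coords R m)) (X Y Z : vfield R m).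

Definition coord_vec (j : 'I_m) : coords R m := delta_mx 0 j.

Fixpoint Cn (k : nat) U (f : coords R m -> R) : Prop :=
  (forall x, U x -> {for x, continuous f}) /\
  if k is k'.+1 then
    forall j : 'I_m,
      (forall x, U x -> derivable f x (coord_vec j)) /\
      Cn k' U (fun x => 'D_(coord_vec j) f x)
  else True.

Definition smooth U (f : coords R m -> R) : Prop := forall k, Cn k U f.

Definition smoothC U (f : coords R m -> R[i]) : Prop :=
  smooth U (fun x => complex.Re (f x)) /\ smooth U (fun x => complex.Im (f x)).

Definition partialC (j : 'I_m) (f : coords R m -> R[i]) (x : coords R m) : R[i] :=
  Complex ('D_(coord_vec j) (fun y => complex.Re (f y)) x)
          ('D_(coord_vec j) (fun y => complex.Im (f y)) x).

Definition dirder X (f : coords R m -> R[i]) (x : coords R m) : R[i] :=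
  \sum_(j < m) X x 0 j * partialC j f x.

Definition smooth_vfield U X : Prop :=
  forall j, smoothC U (fun x => X x 0 j).

Definition bracket X Y : vfield R m := fun x =>
  \row_k (dirder X (fun y => Y y 0 k) x - dirder Y (fun y => X y 0 k) x).

(* Real, smooth, symmetric and non-degenerate; the signature is arbitrary. *)
Definition pseudo_riemannian U (g : metric_field R m) : Prop :=
  [/\ forall i j, smooth U (fun x => g x i j),
      forall x, U x -> (g x)^T = g x
    & forall x, U x -> g x \in unitmx].

(* Complex-bilinear extension of the metric. *)
Definition gC (g : metric_field R m) (x : coords R m) (v w : 'rV[R[i]]_m) : R[i] :=
  (v *m map_mx (real_complex R) (g x) *m w^T) 0 0.

(* Connections on the trivial complex bundle U x E; [sm] singles out the smooth
   sections.  Differentiation along complexified vector fields is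
   complex-linear. *)
Record is_connection U (E : lmodType R[i]) (sm : (coords R m -> E) -> Prop)
    (nab : vfield R m -> (coords R m -> E) -> (coords R m -> E)) : Prop := {
  conn_smooth : forall X s, smooth_vfield U X -> sm s -> sm (nab X s);
  conn_addl : forall X Y s, smooth_vfield U X -> smooth_vfield U Y -> sm s ->
    forall x, U x -> nab (fun y => X y + Y y) s x = nab X s x + nab Y s x;
  conn_scalel : forall f X s, smoothC U f -> smooth_vfield U X -> sm s ->
    forall x, U x -> nab (fun y => f y *: X y) s x = f x *: nab X s x;
  conn_addr : forall X s t, smooth_vfield U X -> sm s -> sm t ->
    forall x, U x -> nab X (fun y => s y + t y) x = nab X s x + nab X t x;
  conn_leibniz : forall f X s, smoothC U f -> smooth_vfield U X -> sm s ->
    forall x, U x ->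
      nab X (fun y => f y *: s y) x = dirder X f x *: s x + f x *: nab X s x
}.

Record levi_civita U (g : metric_field R m)
    (nabla : vfield R m -> vfield R m -> vfield R m) : Prop := {
  lc_connection : @is_connection U 'rV[R[i]]_m (smooth_vfield U) nabla;
  lc_torsion_free : forall X Y, smooth_vfield U X -> smooth_vfield U Y ->
    forall x, U x -> nabla X Y x - nabla Y X x = bracket X Y x;
  lc_metric : forall X Y Z,
    smooth_vfield U X -> smooth_vfield U Y -> smooth_vfield U Z ->
    forall x, U x -> dirder X (fun y => gC g y (Y y) (Z y)) x =
                     gC g x (nabla X Y x) (Z x) + gC g x (Y x) (nabla X Z x)
}.

Definition distribution := coords R m -> set 'rV[R[i]]_m.

Definition tangent_to U (N : distribution) X : Prop :=
  forall x, U x -> N x (X x).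

Definition integrable_distribution U (N : distribution) : Prop :=
  forall X Y, smooth_vfield U X -> smooth_vfield U Y ->
    tangent_to U N X -> tangent_to U N Y -> tangent_to U N (bracket X Y).

(* A complex 1-form alpha is the field of column vectors of its components. *)
Definition smooth_form U (alpha : coords R m -> 'cV[R[i]]_m) : Prop :=
  forall j, smoothC U (fun x => alpha x j 0).

Definition form_app (alpha : coords R m -> 'cV[R[i]]_m) (x : coords R m)
  (v : 'rV[R[i]]_m) : R[i] := (v *m alpha x) 0 0.

End Calculus.

(* An element of the exterior algebra of V^*: the coefficient at
   I = {i1 < ... < ik} is that of theta^i1 /\ ... /\ theta^ik. *)
Notation spinor R n := {ffun {set 'I_n} -> (R[i])^o}.
Notation sfield R n := (coords R (n + n) -> spinor R n) (only parsing).

Section Spinors.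
Variables (R : realType) (n : nat).
Implicit Types (I : {set 'I_n}) (psi : spinor R n).

Definition ext_sign (i : 'I_n) I : R[i] := (-1) ^+ #|[set k in I | (k < i)%N]|.

Definition wedge (j : 'I_n) psi : spinor R n :=
  [ffun I : {set 'I_n} => if j \in I then ext_sign j I * psi (I :\ j) else 0].

Definition contract (i : 'I_n) psi : spinor R n :=
  [ffun I : {set 'I_n} => if i \in I then 0 else ext_sign i I * psi (i |: I)].

Definition spinor_basis I : spinor R n := [ffun J => (J == I)%:R].

Definition smooth_sfield (U : set (coords R (n + n))) (psi : sfield R n) : Prop :=
  forall I, smoothC U (fun x => psi x I).

End Spinors.

Section SpinGeometry.
Variables (R : realType) (n : nat).
Local Notation pt := (coords R (n + n)).
Local Notation vf := (vfield R (n + n)).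
Local Notation sf := (sfield R n).
Variables (U : set pt) (g : metric_field R (n + n)).

Definition null_frame (e theta : 'I_n -> vf) : Prop :=
  [/\ forall i, smooth_vfield U (e i) /\ smooth_vfield U (theta i),
      forall x i j, U x -> gC g x (e i x) (e j x) = 0,
      forall x i j, U x -> gC g x (theta i x) (theta j x) = 0
    & forall x i j, U x -> gC g x (e i x) (theta j x) = (i == j)%:R / 2].

Variables (e theta : 'I_n -> vf).

(* e_1, ..., e_n, e_{n+1} = theta^1, ..., e_{2n} = theta^n *)
Definition frame (a : 'I_(n + n)) : vf :=
  match fintype.split a with inl i => e i | inr j => theta j end.

Definition frame_mx (x : pt) : 'M[R[i]]_(n + n) := \matrix_a frame a x.

(* Components of v with respect to the frame. *)
Definition frame_comp (x : pt) (v : 'rV[R[i]]_(n + n)) : 'rV[R[i]]_(n + n) :=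
  v *m invmx (frame_mx x).

Definition clifford (x : pt) (v : 'rV[R[i]]_(n + n)) (psi : spinor R n) :
    spinor R n :=
  \sum_(i < n) (frame_comp x v 0 (lshift n i) *: contract i psi
                + frame_comp x v 0 (rshift n i) *: wedge i psi).

Definition metric_lower (x : pt) : 'M[R[i]]_(n + n) :=
  \matrix_(a, b) gC g x (frame a x) (frame b x).

Definition metric_upper (x : pt) : 'M[R[i]]_(n + n) := invmx (metric_lower x).

Variable nabla : vf -> vf -> vf.

(* nabla_{e_a} e_b = omega_{ab}^c e_c *)
Definition omega (x : pt) (a b c : 'I_(n + n)) : R[i] :=
  frame_comp x (nabla (frame a) (frame b) x) 0 c.

(* omega_a^{dc} = g^{bd} omega_{ab}^c *)
Definition omega_up (x : pt) (a d c : 'I_(n + n)) : R[i] :=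
  \sum_b metric_upper x b d * omega x a b c.

Record spinorial_connection (nabS : vf -> sf -> sf) : Prop := {
  spin_connection : @is_connection R (n + n) U (spinor R n)
                      (@smooth_sfield R n U) nabS;
  spin_clifford : forall X v psi,
    smooth_vfield U X -> smooth_vfield U v -> smooth_sfield U psi ->
    forall x, U x ->
      nabS X (fun y => clifford y (v y) (psi y)) x =
      clifford x (nabla X v x) (psi x) + clifford x (v x) (nabS X psi x)
}.

(* nabS is the spinorial connection determined by the 1-form A. *)
Definition has_potential (nabS : vf -> sf -> sf)
    (A : pt -> 'cV[R[i]]_(n + n)) : Prop :=
  forall a I x, U x ->
    nabS (frame a) (fun=> spinor_basis R I) x =
      - (4^-1 *: \sum_b \sum_c omega_up x a b c *:
           clifford x (frame b x) (clifford x (frame c x) (spinor_basis R I)))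
      + form_app A x (frame a x) *: spinor_basis R I.

Definition dirac (nabS : vf -> sf -> sf) (psi : sf) : sf := fun x =>
  \sum_a \sum_b metric_upper x a b *:
     clifford x (frame a x) (nabS (frame b) psi x).

Definition twistor (nabS : vf -> sf -> sf) (X : vf) (psi : sf) : sf := fun x =>
  nabS X psi x - (2 * n)%N%:R^-1 *: clifford x (X x) (dirac nabS psi x).

Definition annihilator (phi : sf) : distribution R (n + n) := fun x =>
  [set v | clifford x v (phi x) = 0].

Definition pure_spinor (phi : sf) : Prop :=
  forall x, U x -> phi x != 0 /\
    exists W : {vspace 'rV[R[i]]_(n + n)},
      \dim W = n /\ forall v, v \in W <-> annihilator phi x v.

Definition twistor_vanishes (nabS : vf -> sf -> sf) (phi : sf) : Prop :=
  forall X, smooth_vfield U X -> tangent_to U (annihilator phi) X ->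
    forall x, U x -> twistor nabS X phi x = 0.

End SpinGeometry.

(* Main.v *)
(* Let N be the maximally isotropic distribution of phi; for u orthogonal to N the
   spinor u . phi vanishes, so N is integrable iff T(X, Y, Z) = g(nabla_X Y, Z)
   vanishes for X, Y, Z in N (T is always antisymmetric in Y, Z).  Since
   Y . nab_X phi = - (nabla_X Y) . phi, commuting X through the Dirac operator gives
     X . D phi = 2 nab_X phi + g^{ab} e_a . (nabla_{e_b} X) . phi   for X in N.
   Multiplying the twistor equation by Z . Y and using this formula yields
     n T(X, Y, Z) = T(X, Y, Z) - T(Y, X, Z) + T(Z, X, Y),
   which makes T totally antisymmetric with (n - 3) T = 0.  Conversely, T = 0 implies
   that N annihilates T_X phi, so T_X phi is a multiple of phi; replacing A by
   A + alpha changes it by (1 - 1/n) alpha(X) phi, hence alpha can be chosen to cancel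
   it.  For n = 1 nothing has to be cancelled.  A vector of N extends to a smooth
   section of N by Cramer's rule. *)
Require Import Defs.
From HB Require Import structures.
From mathcomp Require Import all_boot all_order all_algebra.
From mathcomp Require Import all_classical all_reals all_analysis.
From mathcomp Require Import complex.
From mathcomp Require Import ring.
Import Order.TTheory GRing.Theory Num.Theory.
Import numFieldNormedType.Exports.
Local Open Scope classical_set_scope.
Local Open Scope ring_scope.

Set Implicit Arguments.
Unset Strict Implicit.
Unset Printing Implicit Defensive.

(** * Smooth functions *)

(** That a spinor killed by N is a multiple of phi is a dimension count: a basis of N acts by n
    anticommuting operators of square zero on a space of dimension 2^n, and each of them halves the
    joint kernel. Dimension six is exceptional because for a totally antisymmetric T the three terms
    on the right of the cyclic identity coincide, so that it reads n T = 3 T. The first half must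
    also produce a smooth 1-form and an actual spinorial connection. The multiple of phi in T_X phi
    only makes sense for X in N, and N has no preferred complement, so its coefficient has to be
    extended to all X by an auxiliary choice. The connection is built from the local formula in
    omega and A; its Leibniz rule comes down to the fact that the commutator of the omega-term with
    multiplication by e_b is multiplication by nabla e_b. Tensors such as T are pointwise, whereas
    brackets and connections act on fields, and fields are total functions constrained only on U.
    Hence the recurring need for extensions of vectors and for locality of connections. *)

Section SmoothFunctions.
Variables (R : realType) (m : nat) (U : set 'rV[R]_m).
Hypothesis U_open : open U.
Implicit Types (f g : 'rV[R]_m -> R) (u v : 'rV[R]_m -> R[i]).

Lemma near_eq_on f g x : U x -> (forall y, U y -> f y = g y) ->
  \near x, f x = g x.
Proof.
move=> Ux fg; have := open_nbhs_nbhs (conj U_open Ux).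
by apply: filterS => y /fg.
Qed.

Lemma Cn_eq k f g : (forall y, U y -> f y = g y) -> Cn k U f -> Cn k U g.
Proof.
elim: k f g => [|k IH] f g fg /= [cf df]; split=> //.
- move=> x Ux; have := cf x Ux; rewrite /prop_for /continuous_at fg //.
  by apply: cvg_trans; apply: (@near_eq_cvg _ _ (nbhs x)); exact: near_eq_on.
- move=> x Ux; have := cf x Ux; rewrite /prop_for /continuous_at fg //.
  by apply: cvg_trans; apply: (@near_eq_cvg _ _ (nbhs x)); exact: near_eq_on.
move=> j; have [dj Dj] := df j; split.
  by move=> x Ux; apply: near_eq_derivable (dj x Ux); exact: near_eq_on.
by apply: IH Dj => y Uy; apply: near_eq_derive; exact: near_eq_on.
Qed.

Lemma Cn_pred k f : Cn k.+1 U f -> Cn k U f.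
Proof.
elim: k f => [|k IH] f; first by case.
move=> [cf df]; split=> // j; have [dj Dj] := df j; split=> //; exact: IH.
Qed.

Lemma CnD k f g : Cn k U f -> Cn k U g -> Cn k U (fun x => f x + g x).
Proof.
elim: k f g => [|k IH] f g [cf df] [cg dg].
  by split=> // x Ux; exact: (cvgD (cf x Ux) (cg x Ux)).
split=> [x Ux|j]; first by exact: (cvgD (cf x Ux) (cg x Ux)).
have [dfj Dfj] := df j; have [dgj Dgj] := dg j; split=> [x Ux|].
  by apply: derivableD; [exact: dfj|exact: dgj].
apply: Cn_eq (IH _ _ Dfj Dgj) => y Uy.
by rewrite -deriveD; [|exact: dfj|exact: dgj].
Qed.

Lemma CnM k f g : Cn k U f -> Cn k U g -> Cn k U (fun x => f x * g x).
Proof.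
elim: k f g => [|k IH] f g.
  by move=> [cf df] [cg dg]; split=> // x Ux; exact: (cvgM (cf x Ux) (cg x Ux)).
move=> Cf Cg; have [cf df] := Cf; have [cg dg] := Cg.
split=> [x Ux|j]; first by exact: (cvgM (cf x Ux) (cg x Ux)).
have [dfj Dfj] := df j; have [dgj Dgj] := dg j; split=> [x Ux|].
  by apply: derivableM; [exact: dfj|exact: dgj].
apply: Cn_eq (CnD (IH _ _ (Cn_pred Cf) Dgj) (IH _ _ (Cn_pred Cg) Dfj)) => y Uy.
exact: esym (deriveM (dfj y Uy) (dgj y Uy)).
Qed.

Lemma Cn_cst k (c : R) : Cn k U (fun=> c).
Proof.
elim: k c => [|k IH] c; first by split=> // x _; exact: cst_continuous.
split=> [x _|j]; first exact: cst_continuous.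
split=> [x _|]; first exact: derivable_cst.
by apply: Cn_eq (IH 0) => y _; rewrite derive_cst.
Qed.

(** The induction keeps [f] fixed: the derivative of 1/f is -(1/f)^2 f', which involves 1/f itself
    only at the previous order. *)
Lemma CnV k f : (forall x, U x -> f x != 0) -> Cn k U f ->
  Cn k U (fun x => (f x)^-1).
Proof.
move=> f0; elim: k => [|k IH].
  by move=> [cf df]; split=> // x Ux; exact: (cvgV (f0 x Ux) (cf x Ux)).
move=> Cf; have [cf df] := Cf.
split=> [x Ux|j]; first by exact: (cvgV (f0 x Ux) (cf x Ux)).
have [dfj Dfj] := df j; split=> [x Ux|].
  by apply: derivableV; [exact: f0|exact: dfj].
have CV := IH (Cn_pred Cf).
apply: Cn_eq (CnM (CnM (Cn_cst k (-1)) (CnM CV CV)) Dfj) => y Uy.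
by rewrite deriveV; [rewrite mulN1r -expr2 exprVn| exact: f0|exact: dfj].
Qed.

Lemma smooth_eq f g : (forall y, U y -> f y = g y) -> smooth U f -> smooth U g.
Proof. by move=> fg sf k; apply: Cn_eq (sf k). Qed.

Lemma smoothD f g : smooth U f -> smooth U g -> smooth U (fun x => f x + g x).
Proof. by move=> sf sg k; exact: CnD. Qed.

Lemma smoothM f g : smooth U f -> smooth U g -> smooth U (fun x => f x * g x).
Proof. by move=> sf sg k; exact: CnM. Qed.

Lemma smooth_cst c : smooth U (fun=> c).
Proof. by move=> k; exact: Cn_cst. Qed.

Lemma smoothV f : (forall x, U x -> f x != 0) -> smooth U f ->
  smooth U (fun x => (f x)^-1).
Proof. by move=> f0 sf k; exact: CnV. Qed.

Lemma smoothN f : smooth U f -> smooth U (fun x => - f x).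
Proof.
move=> sf; apply: smooth_eq (smoothM (smooth_cst (-1)) sf) => y _.
by rewrite mulN1r.
Qed.

Lemma smooth_derivable f j x : smooth U f -> U x ->
  derivable f x (coord_vec R j).
Proof. by move=> /(_ 1%N)[_ /(_ j)[+ _]]; exact. Qed.

Lemma smooth_derive f j : smooth U f ->
  smooth U (fun x => 'D_(coord_vec R j) f x).
Proof. by move=> sf k; have [_ /(_ j)[]] := sf k.+1. Qed.

Lemma smoothC_eq u v : (forall y, U y -> u y = v y) ->
  smoothC U u -> smoothC U v.
Proof.
by move=> uv [su su']; split; [move: su|move: su']; apply: smooth_eq => y Uy;
  rewrite uv.
Qed.

Lemma smoothC_cst c : smoothC U (fun=> c).
Proof. by split; exact: smooth_cst. Qed.

Lemma smoothCD u v : smoothC U u -> smoothC U v -> smoothC U (fun x => u x + v x).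
Proof.
move=> [ru iu] [rv iv]; split.
  by apply: smooth_eq (smoothD ru rv) => y _; case: (u y) (v y) => ? ? [].
by apply: smooth_eq (smoothD iu iv) => y _; case: (u y) (v y) => ? ? [].
Qed.

Lemma smoothCM u v : smoothC U u -> smoothC U v -> smoothC U (fun x => u x * v x).
Proof.
move=> [ru iu] [rv iv]; split.
  apply: smooth_eq (smoothD (smoothM ru rv) (smoothN (smoothM iu iv))) => y _.
  by case: (u y) (v y) => ? ? [].
apply: smooth_eq (smoothD (smoothM ru iv) (smoothM iu rv)) => y _.
by case: (u y) (v y) => ? ? [].
Qed.

Lemma smoothC_conj u : smoothC U u -> smoothC U (fun x => (u x)^*%C).
Proof.
move=> [ru iu]; split; first by apply: smooth_eq ru => y _; case: (u y).
by apply: smooth_eq (smoothN iu) => y _; case: (u y).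
Qed.

Lemma smoothCN u : smoothC U u -> smoothC U (fun x => - u x).
Proof.
move=> su; apply: smoothC_eq (smoothCM (smoothC_cst (-1)) su) => y _.
by rewrite mulN1r.
Qed.

(** The reciprocal is the conjugate divided by |u|^2, a real function without zeros on U. *)
Lemma smoothCV u : (forall x, U x -> u x != 0) -> smoothC U u ->
  smoothC U (fun x => (u x)^-1).
Proof.
move=> u0 su; have [ru iu] := su.
have norm0 x : U x -> complex.Re (u x) * complex.Re (u x) +
    complex.Im (u x) * complex.Im (u x) != 0.
  move=> /u0; apply: contra; case: (u x) => a b /=.
  by rewrite paddr_eq0 ?sqr_ge0 -?expr2 ?sqr_ge0 // !sqrf_eq0 eq_complex.
have sN := smoothV norm0 (smoothD (smoothM ru ru) (smoothM iu iu)).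
split.
  apply: smooth_eq (smoothM ru sN) => y _.
  by case: (u y) => a b /=; rewrite !expr2.
apply: smooth_eq (smoothN (smoothM iu sN)) => y _.
by case: (u y) => a b /=; rewrite !expr2.
Qed.

Lemma smoothC_sum I (s : seq I) (P : pred I) (u : I -> 'rV[R]_m -> R[i]) :
  (forall i, smoothC U (u i)) -> smoothC U (fun x => \sum_(i <- s | P i) u i x).
Proof.
move=> su; elim: s => [|i s IH].
  by apply: smoothC_eq (smoothC_cst 0) => y _; rewrite big_nil.
case Pi: (P i); last by apply: smoothC_eq IH => y _; rewrite big_cons Pi.
by apply: smoothC_eq (smoothCD (su i) IH) => y _; rewrite big_cons Pi.
Qed.

Lemma smoothC_prod I (s : seq I) (P : pred I) (u : I -> 'rV[R]_m -> R[i]) :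
  (forall i, smoothC U (u i)) -> smoothC U (fun x => \prod_(i <- s | P i) u i x).
Proof.
move=> su; elim: s => [|i s IH].
  by apply: smoothC_eq (smoothC_cst 1) => y _; rewrite big_nil.
case Pi: (P i); last by apply: smoothC_eq IH => y _; rewrite big_cons Pi.
by apply: smoothC_eq (smoothCM (su i) IH) => y _; rewrite big_cons Pi.
Qed.

Lemma partialC_eq j u v x : U x -> (forall y, U y -> u y = v y) ->
  partialC j u x = partialC j v x.
Proof.
move=> Ux uv; rewrite /partialC; congr Complex;
  by apply: near_eq_derive; apply: near_eq_on => // y Uy; rewrite uv.
Qed.

Lemma partialC_cst j (c : R[i]) (x : 'rV[R]_m) : partialC j (fun=> c) x = 0.
Proof. by rewrite /partialC !derive_cst. Qed.

Lemma partialCD j u v x : smoothC U u -> smoothC U v -> U x ->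
  partialC j (fun y => u y + v y) x = partialC j u x + partialC j v x.
Proof.
move=> [ru iu] [rv iv] Ux; rewrite /partialC.
have -> : (fun y => complex.Re (u y + v y)) =
    (fun y => complex.Re (u y)) + (fun y => complex.Re (v y)).
  by apply/funext => y; rewrite !fctE; case: (u y) (v y) => ? ? [].
have -> : (fun y => complex.Im (u y + v y)) =
    (fun y => complex.Im (u y)) + (fun y => complex.Im (v y)).
  by apply/funext => y; rewrite !fctE; case: (u y) (v y) => ? ? [].
rewrite (deriveD (smooth_derivable ru Ux) (smooth_derivable rv Ux)).
by rewrite (deriveD (smooth_derivable iu Ux) (smooth_derivable iv Ux)).
Qed.

Lemma partialCM j u v x : smoothC U u -> smoothC U v -> U x ->
  partialC j (fun y => u y * v y) x = partialC j u x * v x + u x * partialC j v x.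
Proof.
move=> [ru iu] [rv iv] Ux; rewrite /partialC /=.
have dru := @smooth_derivable _ j _ ru Ux.
have diu := @smooth_derivable _ j _ iu Ux.
have drv := @smooth_derivable _ j _ rv Ux.
have div := @smooth_derivable _ j _ iv Ux.
have -> : (fun y => complex.Re (u y * v y)) =
    (fun y => complex.Re (u y)) * (fun y => complex.Re (v y)) -
    (fun y => complex.Im (u y)) * (fun y => complex.Im (v y)).
  by apply/funext => y; rewrite !fctE; case: (u y) (v y) => ? ? [].
have -> : (fun y => complex.Im (u y * v y)) =
    (fun y => complex.Re (u y)) * (fun y => complex.Im (v y)) +
    (fun y => complex.Im (u y)) * (fun y => complex.Re (v y)).
  by apply/funext => y; rewrite !fctE; case: (u y) (v y) => ? ? [].
rewrite (deriveB (derivableM dru drv) (derivableM diu div)).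
rewrite (deriveD (derivableM dru div) (derivableM diu drv)).
rewrite (deriveM dru drv) (deriveM diu div) (deriveM dru div) (deriveM diu drv).
rewrite /GRing.scale /=.
move: ('D_ _ _ _) ('D_ _ _ _) ('D_ _ _ _) ('D_ _ _ _) => p q r s.
case: (u x) (v x) => a b [c d] /=; apply/eqP; rewrite eq_complex /=.
by apply/andP; split; apply/eqP; ring.
Qed.

Lemma smoothC_partial j u : smoothC U u -> smoothC U (partialC j u).
Proof. by move=> [ru iu]; split; exact: smooth_derive. Qed.

End SmoothFunctions.

(** * Derivatives along complex vector fields *)

Section DirectionalDerivatives.
Variables (R : realType) (m : nat) (U : set 'rV[R]_m).
Hypothesis U_open : open U.
Implicit Types (u v : 'rV[R]_m -> R[i]) (X Y : 'rV[R]_m -> 'rV[R[i]]_m).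

Lemma dirder_eq X Y u v x : U x -> X x = Y x -> (forall y, U y -> u y = v y) ->
  dirder X u x = dirder Y v x.
Proof.
move=> Ux XY uv; apply: eq_bigr => j _; rewrite XY.
by rewrite (partialC_eq U_open j Ux uv).
Qed.

Lemma dirder_cst X c x : dirder X (fun=> c) x = 0.
Proof. by apply: big1 => j _; rewrite partialC_cst mulr0. Qed.

Lemma dirderD X u v x : smoothC U u -> smoothC U v -> U x ->
  dirder X (fun y => u y + v y) x = dirder X u x + dirder X v x.
Proof.
move=> su sv Ux; rewrite -big_split; apply: eq_bigr => j _ /=.
by rewrite (partialCD j su sv Ux) mulrDr.
Qed.

Lemma dirderM X u v x : smoothC U u -> smoothC U v -> U x ->
  dirder X (fun y => u y * v y) x = dirder X u x * v x + u x * dirder X v x.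
Proof.
move=> su sv Ux; rewrite mulr_suml mulr_sumr -big_split.
apply: eq_bigr => j _ /=; rewrite (partialCM j su sv Ux); ring.
Qed.

Lemma dirder_addl X Y u x :
  dirder (fun y => X y + Y y) u x = dirder X u x + dirder Y u x.
Proof.
by rewrite -big_split; apply: eq_bigr => j _ /=; rewrite mxE mulrDl.
Qed.

Lemma dirder_scalel f X u x :
  dirder (fun y => f y *: X y) u x = f x * dirder X u x.
Proof.
by rewrite mulr_sumr; apply: eq_bigr => j _ /=; rewrite mxE mulrA.
Qed.

Lemma smoothC_dirder X u : smooth_vfield U X -> smoothC U u ->
  smoothC U (dirder X u).
Proof.
move=> sX su; apply: smoothC_sum => // j.
exact: smoothCM (sX j) (smoothC_partial j su).
Qed.

End DirectionalDerivatives.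

(** * Smooth matrix-valued functions *)

Section SmoothMatrices.
Variables (R : realType) (m : nat) (U : set 'rV[R]_m).
Hypothesis U_open : open U.

Definition smooth_mx p q (M : 'rV[R]_m -> 'M[R[i]]_(p, q)) :=
  forall i j, smoothC U (fun x => M x i j).

Lemma smooth_vfieldP X : smooth_mx X <-> smooth_vfield U X.
Proof. by split=> sX => [j|i j]; [exact: sX|rewrite ord1; exact: sX]. Qed.

Lemma smooth_mx_cst p q (M : 'M[R[i]]_(p, q)) : smooth_mx (fun=> M).
Proof. by move=> i j; exact: smoothC_cst. Qed.

Lemma smooth_mulmx p q r (M : 'rV[R]_m -> 'M[R[i]]_(p, q))
    (N : 'rV[R]_m -> 'M[R[i]]_(q, r)) :
  smooth_mx M -> smooth_mx N -> smooth_mx (fun x => M x *m N x).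
Proof.
move=> sM sN i j.
apply: (smoothC_eq U_open (u := fun x => \sum_k M x i k * N x k j)) => [x _|].
  by rewrite mxE.
by apply: smoothC_sum => // k; exact: smoothCM.
Qed.

Lemma smooth_det p (M : 'rV[R]_m -> 'M[R[i]]_p) :
  smooth_mx M -> smoothC U (fun x => \det (M x)).
Proof.
move=> sM; apply: smoothC_sum => // s; apply: smoothCM => //.
  exact: smoothC_cst.
by apply: smoothC_prod => // i; exact: sM.
Qed.

Lemma smooth_adj p (M : 'rV[R]_m -> 'M[R[i]]_p) :
  smooth_mx M -> smooth_mx (fun x => \adj (M x)).
Proof.
move=> sM i j.
apply: (smoothC_eq U_open (u := fun x => cofactor (M x) j i)) => [x _|].
  by rewrite mxE.
apply: smoothCM => //; first exact: smoothC_cst.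
apply: smooth_det => k l; apply: smoothC_eq (sM (lift j k) (lift i l)) => // x _.
by rewrite !mxE.
Qed.

(** Cramer's rule: the determinant and the cofactors are polynomials in the entries. *)
Lemma smooth_invmx p (M : 'rV[R]_m -> 'M[R[i]]_p) :
  (forall x, U x -> M x \in unitmx) -> smooth_mx M ->
  smooth_mx (fun x => invmx (M x)).
Proof.
move=> uM sM i j.
apply: (smoothC_eq U_open (u := fun x => (\det (M x))^-1 * (\adj (M x)) i j)).
  move=> x Ux; rewrite /invmx uM //.
  by rewrite [RHS]mxE.
apply: smoothCM => //; last exact: smooth_adj.
by apply: smoothCV => //; exact: smooth_det.
Qed.

End SmoothMatrices.

(** * The Clifford algebra *)

Section CliffordGenerators.
Variables (R : realType) (n : nat).
Implicit Types (I : {set 'I_n}) (psi : spinor R n).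
Local Notation contract := (@Defs.contract R n).

(** Removing i lowers the count in [ext_sign] by one exactly when i < j. Since one of i < j and j <
    i holds for distinct indices, this produces the anticommutation signs below. *)
Lemma ext_signD1 i j I : i \in I ->
  ext_sign R j (I :\ i) = (-1) ^+ (i < j)%N * ext_sign R j I.
Proof.
move=> iI; rewrite /ext_sign.
rewrite [X in _ = _ * (-1) ^+ X](cardsD1 i) !inE iI /= exprD mulrA -expr2 sqrr_sign.
rewrite mul1r; congr (_ ^+ _); apply: eq_card => k; rewrite !inE.
by rewrite andbA.
Qed.

Lemma ext_signU1 i j I : i \notin I ->
  ext_sign R j (i |: I) = (-1) ^+ (i < j)%N * ext_sign R j I.
Proof.
move=> iI; have := @ext_signD1 i j (i |: I); rewrite finset.setU1K // => -> //.
  by rewrite mulrA -expr2 sqrr_sign mul1r.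
by rewrite setU11.
Qed.

Lemma ext_sign_sq i I : ext_sign R i I * ext_sign R i I = 1.
Proof. by rewrite -expr2 sqrr_sign. Qed.

Lemma sign_ltnN (i j : 'I_n) : i != j ->
  (-1) ^+ (i < j)%N = - (-1) ^+ (j < i)%N :> R[i].
Proof.
by rewrite -val_eqE; case: ltngtP => //= _ _; rewrite ?expr1 ?expr0 ?opprK.
Qed.

Lemma wedgeN (i j : 'I_n) psi : wedge i (wedge j psi) + wedge j (wedge i psi) = 0.
Proof.
apply/ffunP => I; rewrite !ffunE !inE.
have [iI|_] := boolP (i \in I); have [jI|_] := boolP (j \in I);
  rewrite ?andbF ?andbT ?mulr0 ?addr0 ?if_same //.
have [->|ij] /= := eqVneq i j; first by rewrite mulr0 addr0.
rewrite !ext_signD1 // (sign_ltnN ij).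
have -> : I :\ j :\ i = I :\ i :\ j by rewrite !finset.setDDl finset.setUC.
ring.
Qed.

Lemma contractN (i j : 'I_n) psi :
  contract i (contract j psi) + contract j (contract i psi) = 0.
Proof.
apply/ffunP => I; rewrite !ffunE !inE.
have [iI|iI] := boolP (i \in I); have [jI|jI] := boolP (j \in I);
  rewrite ?orbF ?orbT ?mulr0 ?addr0 ?if_same //.
have [->|ij] /= := eqVneq i j; first by rewrite mulr0 addr0.
rewrite !ext_signU1 // (sign_ltnN ij).
by rewrite finset.setUCA; ring.
Qed.

Lemma contract_wedge (i j : 'I_n) psi :
  contract i (wedge j psi) + wedge j (contract i psi) = (i == j)%:R *: psi.
Proof.
apply/ffunP => I; rewrite !ffunE !inE.
have [->|ij] := eqVneq i j.
  (* On the diagonal exactly one of the two terms survives, according to whether j lies in I. *)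
  rewrite /= scale1r; have [jI|jI] := boolP (j \in I).
    by rewrite add0r finset.setD1K // mulrA ext_signD1 // ltnn expr0 mul1r ext_sign_sq mul1r.
  by rewrite addr0 finset.setU1K // mulrA ext_signU1 // ltnn expr0 mul1r ext_sign_sq mul1r.
rewrite /= scale0r.
have [iI|iI] := boolP (i \in I); have [jI|jI] := boolP (j \in I);
  rewrite ?mulr0 ?addr0 //.
rewrite ext_signU1 // ext_signD1 // (sign_ltnN ij).
have -> : (i |: I) :\ j = i |: I :\ j.
  apply/setP => k; rewrite !inE; have [->|] := eqVneq k i; last by [].
  by rewrite ij.
by rewrite /GRing.scale /=; ring.
Qed.

Lemma wedge_is_linear j : linear (@wedge R n j).
Proof.
move=> a psi chi; apply/ffunP => I; rewrite !ffunE.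
by case: ifP => _; rewrite ?scaler0 ?addr0 // /GRing.scale /=; ring.
Qed.

Lemma contract_is_linear j : linear (contract j).
Proof.
move=> a psi chi; apply/ffunP => I; rewrite !ffunE.
by case: ifP => _; rewrite ?scaler0 ?addr0 // /GRing.scale /=; ring.
Qed.

(* The Clifford action of the frame vector e_a; it does not depend on the
   point. *)
Definition gamma (a : 'I_(n + n)) psi : spinor R n :=
  match fintype.split a with inl i => contract i psi | inr j => wedge j psi end.

Lemma gamma_is_linear a : linear (gamma a).
Proof.
by rewrite /gamma; case: (fintype.split a) => i;
  [exact: contract_is_linear|exact: wedge_is_linear].
Qed.

HB.instance Definition _ a := GRing.isLinear.Build _ _ _ _ (gamma a)
  (gamma_is_linear a).

(* The pairing 2 g(e_a, e_b). *)
Definition pairing (a b : 'I_(n + n)) : R[i] :=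
  match fintype.split a, fintype.split b with
  | inl i, inr j | inr i, inl j => (i == j)%:R
  | _, _ => 0
  end.

Lemma gamma_anticomm a b psi :
  gamma a (gamma b psi) + gamma b (gamma a psi) = pairing a b *: psi.
Proof.
rewrite /gamma /pairing; case: (fintype.split a) => i; case: (fintype.split b) => j.
- by rewrite contractN scale0r.
- exact: contract_wedge.
- by rewrite addrC eq_sym contract_wedge.
- by rewrite wedgeN scale0r.
Qed.

End CliffordGenerators.

Lemma sum_combination (K : comNzRingType) (V : lmodType K) (I J : finType) (c : K)
    (w : I -> J -> V) (f : I -> J -> K) (v : I -> V) :
  c *: (\sum_i \sum_j w i j) - c *: (\sum_i (\sum_j f i j) *: v i) =
  \sum_i \sum_j (c *: w i j - (c * f i j) *: v i).
Proof.
rewrite -scalerBr -sumrB scaler_sumr; apply: eq_bigr => i _.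
rewrite scaler_suml -sumrB scaler_sumr; apply: eq_bigr => j _.
by rewrite scalerBr scalerA.
Qed.

Lemma scale_combinationD (K : comNzRingType) (V : lmodType K) (c s t : K) (u v : V) :
  t *: ((c * s) *: u + v) = c *: ((t * s) *: u) + t *: v.
Proof. by rewrite scalerDr !scalerA mulrCA. Qed.

Lemma scale_combinationB (K : comNzRingType) (V : lmodType K) (c s r t : K) (u v : V) :
  t *: ((c * s) *: u - (c * r) *: v) = c *: ((t * s) *: u) - (c * (t * r)) *: v.
Proof. by rewrite scalerBr !scalerA !(mulrCA c). Qed.

Lemma linear_combination (K : comNzRingType) (V W : lmodType K) (f : {linear V -> W})
    (t c : K) (u v w : V) :
  f (t *: (c *: u + c *: v - c *: w)) = t *: (c *: f u + c *: f v - c *: f w).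
Proof. by rewrite linearZ linearB linearD !linearZ. Qed.

(** Compares the coefficients of phi after the twistor equation is multiplied by Z . Y; here a, b, c
    stand for T(X, Y, Z), T(Y, X, Z), T(Z, X, Y), and each factor 2 next to them comes from the
    Clifford relation. *)
Lemma twistor_scalars (K : numFieldType) (V : lmodType K) n (p : V) (a b c : K) :
  (0 < n)%N -> p != 0 ->
  (- (2 * a)) *: p = (2 * n)%N%:R^-1 *:
    (2 *: ((- (2 * a)) *: p) + 2 *: ((2 * b) *: p) - 2 *: ((2 * c) *: p)) ->
  n%:R * a = a - b + c.
Proof.
move=> n0 p0 /eqP; rewrite !scalerA -scalerDl -scalerBl scalerA -subr_eq0.
rewrite -scalerBl scaler_eq0 (negPf p0) orbF subr_eq0 natrM => /eqP E.
have nR0 : n%:R != 0 :> K by rewrite pnatr_eq0 -lt0n.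
have -> : n%:R * a = - (n%:R * (- (2 * a)) / 2) by field.
by rewrite E; field.
Qed.

(** * Joint kernels of anticommuting operators of square zero *)

Section JointKernel.
Variables (K : fieldType) (V : vectType K) (n : nat) (v w : 'I_n -> 'End(V)).
Hypothesis v_anticomm : forall i j psi, v i (v j psi) + v j (v i psi) = 0.
Hypothesis v_sq : forall i psi, v i (v i psi) = 0.
Hypothesis vw_anticomm :
  forall i j psi, v i (w j psi) + w j (v i psi) = (i == j)%:R *: psi.

Definition joint_ker (k : nat) : {vspace V} :=
  (\bigcap_(i < n | (i < k)%N) lker (v i))%VS.

Lemma mem_joint_ker k psi :
  reflect (forall i : 'I_n, (i < k)%N -> v i psi = 0) (psi \in joint_ker k).
Proof.
apply: (iffP subv_bigcapP) => H i ik; last by rewrite -memvE memv_ker H.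
by move: (H i ik); rewrite -memvE memv_ker => /eqP.
Qed.

(* v_k maps the joint kernel of the earlier operators onto the next one, since
   a spinor killed by v_k equals v_k w_k of itself: the dimension halves. *)
Lemma dim_joint_kerS k : (k < n)%N ->
  \dim (joint_ker k) = (\dim (joint_ker k.+1)).*2.
Proof.
move=> kn; pose i := Ordinal kn.
have kerS psi : (psi \in joint_ker k.+1) =
    (psi \in joint_ker k) && (psi \in lker (v i)).
  apply/mem_joint_ker/andP => [H|[/mem_joint_ker H ker_i] j].
    split; last by rewrite memv_ker H //= ltnSn.
    by apply/mem_joint_ker => j jk; apply: H; apply: ltnW.
  rewrite ltnS leq_eqVlt => /orP[/eqP jk|]; last exact: H.
  have -> : j = i by exact: val_inj.
  by move: ker_i; rewrite memv_ker => /eqP.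
rewrite -(limg_ker_dim (v i) (joint_ker k)) -addnn; congr (_ + _)%N.
  congr (\dim _); apply/vspaceP => psi.
  by rewrite kerS memv_cap.
congr (\dim _); apply/vspaceP => psi; rewrite kerS.
apply/memv_imgP/andP => [[chi /mem_joint_ker H ->]|[/mem_joint_ker H ker_i]].
  split; last by rewrite memv_ker v_sq.
  apply/mem_joint_ker => j jk; move/eqP: (v_anticomm j i chi).
  by rewrite (H j jk) linear0 addr0 => /eqP.
move: ker_i; rewrite memv_ker => /eqP ker_i.
exists (w i psi); last first.
  by have := vw_anticomm i i psi; rewrite ker_i linear0 addr0 eqxx scale1r.
(* The preimage stays in the earlier kernels: for j < k the indices j and i differ, so v_j and w_i
   anticommute, and v_j kills psi. *)
apply/mem_joint_ker => j jk; move/eqP: (vw_anticomm j i psi).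
rewrite (H j jk) linear0 addr0.
have -> : (j == i) = false by apply/negbTE; rewrite -val_eqE /= neq_ltn jk.
by rewrite scale0r => /eqP.
Qed.

Lemma dim_joint_ker k : (k <= n)%N ->
  (\dim (joint_ker k) * 2 ^ k = dim V)%N.
Proof.
elim: k => [|k IH] kn.
  rewrite muln1 -dimvf; congr (\dim _); apply/vspaceP => psi.
  by rewrite memvf; apply/mem_joint_ker.
rewrite -(IH (ltnW kn)) (dim_joint_kerS kn) expnS -muln2 mulnA.
by rewrite -mulnA.
Qed.

(** After n halvings of 2^n the joint kernel is one-dimensional, hence spanned by its nonzero
    element phi. *)
Lemma joint_ker_line phi psi : (dim V = 2 ^ n)%N -> phi != 0 ->
  (forall i, v i phi = 0) -> (forall i, v i psi = 0) ->
  exists c, psi = c *: phi.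
Proof.
move=> dimV phi0 kphi kpsi.
have dim1 : \dim (joint_ker n) = 1.
  have /eqP := dim_joint_ker (leqnn n); rewrite dimV -{2}[(2 ^ n)%N]mul1n.
  by rewrite eqn_mul2r expn_eq0 /= => /eqP.
have in_ker chi : (forall i, v i chi = 0) -> chi \in joint_ker n.
  by move=> H; apply/mem_joint_ker.
have /eqP line : (<[phi]> == joint_ker n)%VS.
  by rewrite eqEdim dim1 dim_vline phi0 andbT -memvE in_ker.
have : psi \in <[phi]>%VS by rewrite line in_ker.
by case/vlineP => c ->; exists c.
Qed.

End JointKernel.

Lemma dim_spinor (R : realType) n : dim (spinor R n) = (2 ^ n)%N.
Proof.
have -> : (2 ^ n = #|powerset [set: 'I_n]|)%N.
  by rewrite card_powerset cardsT card_ord.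
rewrite -[RHS]muln1; congr (_ * _)%N.
by apply: eq_card => I; rewrite !inE finset.subsetT.
Qed.

(* A sealed copy of [clifford]: letting conversion unfold the original, down to
   the arithmetic of [R[i]], makes rewriting intractable. *)
HB.lock Definition clifford_mul (R : realType) (n : nat)
    (e theta : 'I_n -> 'rV[R]_(n + n) -> 'rV[R[i]]_(n + n))
    (x : 'rV[R]_(n + n)) (v : 'rV[R[i]]_(n + n)) (psi : spinor R n) : spinor R n :=
  clifford e theta x v psi.

Lemma clifford_mulE (R : realType) (n : nat)
    (e theta : 'I_n -> 'rV[R]_(n + n) -> 'rV[R[i]]_(n + n)) :
  clifford_mul e theta = clifford e theta.
Proof. by rewrite clifford_mul.unlock. Qed.

(** * The metric and the Clifford action in a null frame *)

Section PointwiseGeometry.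
Variables (R : realType) (n : nat) (U : set 'rV[R]_(n + n)).
Variables (g : 'rV[R]_(n + n) -> 'M[R]_(n + n)).
Variables (e theta : 'I_n -> 'rV[R]_(n + n) -> 'rV[R[i]]_(n + n)).
Hypothesis g_metric : pseudo_riemannian U g.
Hypothesis frameP : null_frame U g e theta.

Local Notation GC x := (map_mx (real_complex R) (g x)).
Local Notation clif := (clifford_mul e theta).
Local Notation fc := (frame_comp e theta).
Local Notation fr := (frame e theta).
Implicit Types (x : 'rV[R]_(n + n)) (v w : 'rV[R[i]]_(n + n)).
Implicit Types (psi : spinor R n).

Lemma split_lshift (i : 'I_n) : fintype.split (lshift n i) = inl i.
Proof. exact: (unsplitK (inl i)). Qed.

Lemma split_rshift (i : 'I_n) : fintype.split (rshift n i) = inr i.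
Proof. exact: (unsplitK (inr i)). Qed.

Definition pairing_simp := (split_lshift, split_rshift).

Lemma pairing_sym (a b : 'I_(n + n)) : pairing R a b = pairing R b a.
Proof.
rewrite /pairing; case: (fintype.split a) => i; case: (fintype.split b) => j //.
  by rewrite eq_sym.
by rewrite eq_sym.
Qed.

Lemma sum_delta (I : finType) (i : I) (f : I -> R[i]) :
  \sum_j (i == j)%:R * f j = f i.
Proof.
rewrite (bigD1 i) //= eqxx mul1r big1 ?addr0 // => j.
by rewrite eq_sym => /negPf ->; rewrite mul0r.
Qed.

(** The pairing exchanges the two isotropic halves of the frame, so its matrix squares to 1. As g_ab
    is half of it, g^ab is twice it. *)
Lemma pairing_involutive (a c : 'I_(n + n)) :
  \sum_b pairing R a b * pairing R b c = (a == c)%:R.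
Proof.
rewrite big_split_ord /pairing /=.
case: (split_ordP a) => i ->; case: (split_ordP c) => k ->;
  under eq_bigr do rewrite !pairing_simp ?mul0r ?mulr0;
  under [X in _ + X]eq_bigr do rewrite !pairing_simp ?mul0r ?mulr0.
- by rewrite big1_eq add0r sum_delta eq_lshift.
- by rewrite !big1_eq addr0 eq_lrshift.
- by rewrite !big1_eq addr0 eq_rlshift.
- by rewrite big1_eq addr0 sum_delta eq_rshift.
Qed.

Lemma gC_sym x v w : U x -> gC g x v w = gC g x w v.
Proof.
case: g_metric => _ gT _ Ux; rewrite /gC.
have -> (M : 'M[R[i]]_1) : M 0 0 = M^T 0 0 by rewrite mxE.
by rewrite !trmx_mul trmxK map_trmx gT // mulmxA.
Qed.

Lemma gCDl x v v' w : gC g x (v + v') w = gC g x v w + gC g x v' w.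
Proof. by rewrite /gC !mulmxDl mxE. Qed.

Lemma gCZl x c v w : gC g x (c *: v) w = c * gC g x v w.
Proof. by rewrite /gC -!scalemxAl mxE. Qed.

Lemma gCDr x v w w' : gC g x v (w + w') = gC g x v w + gC g x v w'.
Proof. by rewrite /gC linearD /= mulmxDr mxE. Qed.

Lemma gCZr x c v w : gC g x v (c *: w) = c * gC g x v w.
Proof. by rewrite /gC linearZ /= -scalemxAr mxE. Qed.

Lemma gCBl x v v' w : gC g x (v - v') w = gC g x v w - gC g x v' w.
Proof. by rewrite gCDl -scaleN1r gCZl mulN1r. Qed.

Lemma gC_suml x (I : finType) (c : I -> R[i]) (v : I -> 'rV_(n + n)) w :
  gC g x (\sum_i c i *: v i) w = \sum_i c i * gC g x (v i) w.
Proof.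
elim/big_rec2: _ => [|i y z _ <-]; first by rewrite /gC !mul0mx mxE.
by rewrite gCDl gCZl.
Qed.

Lemma gC_sumr x (I : finType) (c : I -> R[i]) (v : I -> 'rV_(n + n)) w :
  gC g x w (\sum_i c i *: v i) = \sum_i c i * gC g x w (v i).
Proof.
elim/big_rec2: _ => [|i y z _ <-]; first by rewrite /gC trmx0 mulmx0 mxE.
by rewrite gCDr gCZr.
Qed.

Lemma gC_frame x a b : U x -> gC g x (fr a x) (fr b x) = pairing R a b / 2.
Proof.
case: frameP => _ ee tt et Ux; rewrite /frame /pairing.
case: (fintype.split a) => i; case: (fintype.split b) => j.
- by rewrite ee // mul0r.
- exact: et.
- by rewrite gC_sym // et // eq_sym.
- by rewrite tt // mul0r.
Qed.

Lemma metric_lowerE x :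
  metric_lower g e theta x = frame_mx e theta x *m GC x *m (frame_mx e theta x)^T.
Proof.
apply/matrixP => a b; rewrite !mxE /gC mxE; apply: eq_bigr => k _; rewrite !mxE.
by congr (_ * _); apply: eq_bigr => l _; rewrite !mxE.
Qed.

Let upper : 'M[R[i]]_(n + n) := \matrix_(a, b) (2 * pairing R a b).

Lemma metric_lower_upper x : U x -> metric_lower g e theta x *m upper = 1%:M.
Proof.
move=> Ux; apply/matrixP => a c; rewrite !mxE -pairing_involutive.
by apply: eq_bigr => b _; rewrite !mxE gC_frame //; field.
Qed.

Lemma metric_upperE x a b : U x -> metric_upper g e theta x a b = 2 * pairing R a b.
Proof.
move=> Ux; have LU := metric_lower_upper Ux; have [uL _] := mulmx1_unit LU.
suff -> : metric_upper g e theta x = upper by rewrite mxE.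
by rewrite /metric_upper -[RHS](mulKmx uL) LU mulmx1.
Qed.

(** The frame is a basis because its Gram matrix, which has [frame_mx] as left factor, has a right
    inverse. *)
Lemma frame_mx_unit x : U x -> frame_mx e theta x \in unitmx.
Proof.
move=> Ux; have := metric_lower_upper Ux.
by rewrite metric_lowerE -!mulmxA => /mulmx1_unit[].
Qed.

Lemma row_frame_mx x a : row a (frame_mx e theta x) = fr a x.
Proof. by apply/rowP => j; rewrite !mxE. Qed.

Lemma frame_comp_frame x a : U x -> fc x (fr a x) = delta_mx 0 a.
Proof.
move=> Ux; rewrite -row_frame_mx rowE /frame_comp mulmxK //.
exact: frame_mx_unit.
Qed.

Lemma frame_expansion x v : U x -> v = \sum_a fc x v 0 a *: fr a x.
Proof.
move=> Ux; rewrite -[LHS](mulmxKV (frame_mx_unit Ux)) mulmx_sum_row.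
by apply: eq_bigr => a _; rewrite row_frame_mx.
Qed.

Lemma frame_comp_is_linear x : linear (fc x).
Proof. by move=> c v w; rewrite /frame_comp mulmxDl scalemxAl. Qed.

HB.instance Definition _ x := GRing.isLinear.Build _ _ _ _ (frame_comp e theta x)
  (frame_comp_is_linear x).

Lemma cliffordE x v psi : clif x v psi = \sum_a fc x v 0 a *: gamma a psi.
Proof.
rewrite clifford_mulE big_split_ord /= /clifford -big_split; apply: eq_bigr => i _ /=.
by rewrite /gamma !pairing_simp.
Qed.

Lemma clifford_is_linear x v : linear (clif x v).
Proof.
move=> c psi chi; rewrite !cliffordE scaler_sumr -big_split.
apply: eq_bigr => a _ /=.
by rewrite linearP scalerDr !scalerA mulrC.
Qed.

HB.instance Definition _ x v := GRing.isLinear.Build _ _ _ _ (clifford_mul e theta x v)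
  (clifford_is_linear x v).

Lemma cliffordDr x v psi chi : clif x v (psi + chi) = clif x v psi + clif x v chi.
Proof. exact: linearD. Qed.

Lemma cliffordZr x v c psi : clif x v (c *: psi) = c *: clif x v psi.
Proof. exact: linearZ. Qed.

Lemma clifford0r x v : clif x v 0 = 0.
Proof. exact: linear0. Qed.

Lemma cliffordNr x v psi : clif x v (- psi) = - clif x v psi.
Proof. exact: linearN. Qed.

Lemma clifford_sumr x v (I : finType) (psi : I -> spinor R n) :
  clif x v (\sum_i psi i) = \sum_i clif x v (psi i).
Proof. exact: linear_sum. Qed.

Lemma cliffordDl x v w psi : clif x (v + w) psi = clif x v psi + clif x w psi.
Proof.
rewrite !cliffordE -big_split; apply: eq_bigr => a _ /=.
by rewrite linearD mxE scalerDl.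
Qed.

Lemma cliffordZl x c v psi : clif x (c *: v) psi = c *: clif x v psi.
Proof.
rewrite !cliffordE scaler_sumr; apply: eq_bigr => a _.
by rewrite linearZ mxE scalerA.
Qed.

Lemma clifford_suml x (I : finType) (c : I -> R[i]) (v : I -> 'rV_(n + n)) psi :
  clif x (\sum_i c i *: v i) psi = \sum_i c i *: clif x (v i) psi.
Proof.
elim/big_rec2: _ => [|i y z _ <-]; last by rewrite cliffordDl cliffordZl.
by rewrite -(scale0r 0) cliffordZl !scale0r.
Qed.

Lemma clifford_frame x a psi : U x -> clif x (fr a x) psi = gamma a psi.
Proof.
move=> Ux; rewrite cliffordE frame_comp_frame // (bigD1 a) //= mxE !eqxx scale1r.
by rewrite big1 ?addr0 // => b /negPf ba; rewrite mxE ba andbF scale0r.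
Qed.

Lemma gC_frame_comp x v w : U x ->
  gC g x v w = \sum_a \sum_b fc x v 0 a * (fc x w 0 b * (pairing R a b / 2)).
Proof.
move=> Ux; rewrite {1}(frame_expansion v Ux) gC_suml; apply: eq_bigr => a _.
rewrite {1}(frame_expansion w Ux) gC_sumr mulr_sumr; apply: eq_bigr => b _.
by rewrite gC_frame.
Qed.

(** Index raising: contracting g^ab with g(v, e_a) returns the components of v. This is how the
    double sums of the Dirac operator collapse. *)
Lemma frame_compE x v b : U x ->
  fc x v 0 b = \sum_a metric_upper g e theta x a b * gC g x v (fr a x).
Proof.
move=> Ux; rewrite -(sum_delta b (fun c => fc x v 0 c)).
under [RHS]eq_bigr => a _.
  rewrite {1}(frame_expansion v Ux) gC_suml mulr_sumr.
  under eq_bigr do rewrite gC_frame // metric_upperE //.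
  over.
rewrite exchange_big; apply: eq_bigr => c _ /=.
rewrite eq_sym -pairing_involutive mulr_suml; apply: eq_bigr => a _.
by field.
Qed.

Lemma clifford_anticomm x v w psi : U x ->
  clif x v (clif x w psi) + clif x w (clif x v psi) = (2 * gC g x v w) *: psi.
Proof.
move=> Ux; rewrite gC_frame_comp //.
have expand u u' : clif x u (clif x u' psi) =
    \sum_a \sum_b (fc x u 0 a * fc x u' 0 b) *: gamma a (gamma b psi).
  rewrite cliffordE; apply: eq_bigr => a _; rewrite cliffordE linear_sum scaler_sumr.
  by apply: eq_bigr => b _; rewrite linearZ scalerA.
rewrite !expand [X in _ + X]exchange_big -big_split mulr_sumr scaler_suml.
apply: eq_bigr => a _; rewrite -big_split mulr_sumr scaler_suml /=.
apply: eq_bigr => b _; rewrite [fc x w 0 b * _]mulrC -scalerDr gamma_anticomm.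
by rewrite scalerA; congr (_ *: _); field.
Qed.

(** * A pure spinor at a single point *)

Section PurePoint.
Variables (x : 'rV[R]_(n + n)) (p : spinor R n).
Hypotheses (Ux : U x) (p0 : p != 0).
Hypothesis p_pure : exists W : {vspace 'rV[R[i]]_(n + n)},
  \dim W = n /\ forall v, v \in W <-> clif x v p = 0.

Lemma annihilator_basis : exists2 B : 'M[R[i]]_(n, n + n),
  row_free B & forall v, clif x v p = 0 <-> (v <= B)%MS.
Proof.
have [W [dimW WP]] := p_pure.
move: (vbasis W) (vbasisP W); rewrite dimW => X basisX.
pose B := \matrix_(i < n) X`_i.
have mulB (u : 'rV_n) : u *m B = \sum_i u 0 i *: X`_i.
  by rewrite mulmx_sum_row; apply: eq_bigr => i _; rewrite rowK.
exists B.
  apply: inj_row_free => u; rewrite mulB => u0; apply/rowP => i.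
  by rewrite mxE; move/freeP: (basis_free basisX) => /(_ (fun i => u 0 i) u0 i).
move=> v; split=> [/WP vW|/submxP[u ->]].
  apply/submxP; exists (\row_i coord X i v).
  rewrite mulB [LHS](coord_basis basisX vW).
  by apply: eq_bigr => i _; rewrite mxE.
apply/WP; rewrite mulB; apply: rpred_sum => i _; apply: rpredZ.
by apply: (basis_mem basisX); rewrite mem_nth ?size_tuple.
Qed.

Lemma annihilator_isotropic v w :
  clif x v p = 0 -> clif x w p = 0 -> gC g x v w = 0.
Proof.
move=> vp wp; have := clifford_anticomm v w p Ux.
rewrite vp wp !linear0 addr0 => /esym/eqP.
by rewrite scaler_eq0 (negPf p0) orbF mulf_eq0 pnatr_eq0 => /eqP.
Qed.

Lemma gC_rows k l (A : 'M[R[i]]_(k, n + n)) (B : 'M[R[i]]_(l, n + n)) i j :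
  gC g x (row i A) (row j B) = (A *m (GC x *m B^T)) i j.
Proof.
rewrite /gC mulmxA -row_mul !mxE; apply: eq_bigr => s _.
by rewrite [in LHS]mxE; congr (_ * _); rewrite !mxE.
Qed.

Lemma annihilator_rank (B : 'M[R[i]]_(n, n + n)) :
  row_free B -> \rank (GC x *m B^T) = n.
Proof.
move=> freeB; have [_ gT ug] := g_metric.
rewrite -mxrank_tr trmx_mul trmxK map_trmx gT // mxrankMfree.
  exact/eqP.
by rewrite row_free_unit map_unitmx ug.
Qed.

(** By isotropy N lies in its orthogonal complement, the kernel of [GC x *m B^T]; non-degeneracy
    gives the complement dimension 2n - n = n, so the two coincide. *)
Lemma annihilator_maximal v :
  (forall w, clif x w p = 0 -> gC g x v w = 0) -> clif x v p = 0.
Proof.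
have [B freeB BP] := annihilator_basis => vN; apply/BP.
have sub_ker (u : 'rV_(n + n)) : (forall w, clif x w p = 0 -> gC g x u w = 0) ->
    (u <= kermx (GC x *m B^T))%MS.
  move=> uN; apply/sub_kermxP/rowP => j; rewrite [RHS]mxE.
  rewrite -gC_rows; have -> : row 0 u = u by apply/rowP => k; rewrite mxE.
  by apply: uN; apply/BP; exact: row_sub.
apply: submx_trans (sub_ker v vN) _.
have BK : (B <= kermx (GC x *m B^T))%MS.
  apply/row_subP => i; apply: sub_ker => w; apply: annihilator_isotropic.
  by apply/BP; exact: row_sub.
have [_ <-] := mxrank_leqif_sup BK.
by rewrite mxrank_ker annihilator_rank // addnK; exact: freeB.
Qed.

Lemma pure_spinor_line psi :
  (forall v, clif x v p = 0 -> clif x v psi = 0) -> exists c, psi = c *: p.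
Proof.
have [B freeB BP] := annihilator_basis => psiN.
have rowB i : clif x (row i B) p = 0 by apply/BP; exact: row_sub.
(* Full rank yields a left inverse D, that is, vectors dual to the basis of N under g. Halving them
   below cancels the factor 2 of the Clifford relation. *)
have /row_fullP[D DB] : row_full (GC x *m B^T).
  by rewrite /row_full annihilator_rank.
have [v vE] : exists v : 'I_n -> 'End(spinor R n),
    forall i chi, v i chi = clif x (row i B) chi.
  by exists (fun i => linfun (clif x (row i B))) => i chi; exact: lfunE.
have [w wE] : exists w : 'I_n -> 'End(spinor R n),
    forall i chi, w i chi = clif x (2^-1 *: row i D) chi.
  by exists (fun i => linfun (clif x (2^-1 *: row i D))) => i chi; exact: lfunE.
have anti i j chi : v i (v j chi) + v j (v i chi) = 0.
  rewrite (vE i) (vE j chi) (vE j) (vE i chi) clifford_anticomm // annihilator_isotropic //.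
  by rewrite mulr0 scale0r.
apply: (joint_ker_line (v := v) (w := w)) => //.
- move=> i chi; have /eqP := anti i i chi.
  by rewrite -mulr2n -scaler_nat scaler_eq0 pnatr_eq0 => /eqP.
- move=> i j chi; rewrite (vE i) (wE j chi) (wE j) (vE i chi) clifford_anticomm //; congr (_ *: _).
  rewrite gCZr mulrA divff ?pnatr_eq0 // mul1r gC_sym // gC_rows DB mxE.
  by rewrite eq_sym.
- exact: dim_spinor.
- by move=> i; rewrite vE rowB.
- by move=> i; rewrite vE psiN.
Qed.

End PurePoint.

End PointwiseGeometry.

(** * Connections *)

Section KernelInterpolation.
Variables (F : fieldType) (p q r : nat).
Variables (B : 'M[F]_(r, p)) (C : 'M[F]_(q, r)) (v0 : 'rV[F]_p).

(* Cramer's rule; the extra factor \det (B *m M *m C) makes the formula valid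
   also where the minor B *m M *m C degenerates. *)
Definition kernel_section (M : 'M[F]_(p, q)) : 'rV[F]_p :=
  \det (B *m M *m C) *:
    (\det (B *m M *m C) *: v0 - v0 *m M *m C *m \adj (B *m M *m C) *m B).

(** Where the minor d is nonzero, [B *m M] already has the rank of M, so v0 M = w B M for some w.
    The adjugate then turns v0 M C into d w, and both terms in the bracket become d w B M after
    multiplication by M. *)
Lemma kernel_sectionP M : \rank M = r -> kernel_section M *m M = 0.
Proof.
move=> rankM; rewrite /kernel_section; set d := \det _.
have [->|d0] := eqVneq d 0; first by rewrite scale0r mul0mx.
have rankBM : \rank (B *m M) = \rank M.
  apply/eqP; rewrite eqn_leq mxrankM_maxr rankM /=.
  apply: leq_trans (mxrankM_maxl (B *m M) C).
  by rewrite mxrank_unit // unitmxE unitfE.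
have : (v0 *m M <= B *m M)%MS.
  have [_ eqBM] := mxrank_leqif_sup (submxMl B M).
  by apply: submx_trans (submxMl v0 M) _; rewrite -eqBM rankBM.
case/submxP => w wE; rewrite -scalemxAl mulmxBl -scalemxAl wE.
rewrite -[w *m _ *m C]mulmxA -[w *m _ *m \adj _]mulmxA mul_mx_adj mul_mx_scalar.
by rewrite -!scalemxAl -[w *m B *m M]mulmxA subrr scaler0.
Qed.

Lemma kernel_section_id M :
  B *m M *m C = 1%:M -> v0 *m M = 0 -> kernel_section M = v0.
Proof.
by move=> BMC v0M; rewrite /kernel_section BMC det1 v0M !mul0mx subr0 !scale1r.
Qed.

End KernelInterpolation.

Section Connections.
Variables (R : realType) (m : nat) (U : set 'rV[R]_m) (E : lmodType R[i]).
Variables (sm : ('rV[R]_m -> E) -> Prop).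
Variable nab : ('rV[R]_m -> 'rV[R[i]]_m) -> ('rV[R]_m -> E) -> ('rV[R]_m -> E).
Hypothesis U_open : open U.
Hypothesis nabP : is_connection U sm nab.
Implicit Types (X Y : 'rV[R]_m -> 'rV[R[i]]_m) (s : 'rV[R]_m -> E).

Lemma smooth_vfield_eq X Y : (forall y, U y -> X y = Y y) ->
  smooth_vfield U X -> smooth_vfield U Y.
Proof.
by move=> XY sX j; apply: (smoothC_eq U_open _ (sX j)) => y /XY ->.
Qed.

Lemma smooth_vfieldD X Y : smooth_vfield U X -> smooth_vfield U Y ->
  smooth_vfield U (fun y => X y + Y y).
Proof.
move=> sX sY j; apply: (smoothC_eq U_open _ (smoothCD U_open (sX j) (sY j))).
by move=> y _; rewrite mxE.
Qed.

Lemma smooth_vfieldZ f X : smoothC U f -> smooth_vfield U X ->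
  smooth_vfield U (fun y => f y *: X y).
Proof.
move=> sf sX j; apply: (smoothC_eq U_open _ (smoothCM U_open sf (sX j))).
by move=> y _; rewrite mxE.
Qed.

Lemma smooth_vfield_cst v : smooth_vfield U (fun=> v).
Proof. by move=> j; exact: smoothC_cst. Qed.

Lemma smooth_vfield_sum (I : Type) (t : seq I) (f : I -> 'rV[R]_m -> R[i])
    (X : I -> 'rV[R]_m -> 'rV[R[i]]_m) :
  (forall i, smoothC U (f i)) -> (forall i, smooth_vfield U (X i)) ->
  smooth_vfield U (fun y => \sum_(i <- t) f i y *: X i y).
Proof.
move=> sf sX; elim: t => [|i t IH].
  by apply: smooth_vfield_eq (smooth_vfield_cst 0) => y _; rewrite big_nil.
apply: smooth_vfield_eq (smooth_vfieldD (smooth_vfieldZ (sf i) (sX i)) IH).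
by move=> y _; rewrite big_cons.
Qed.

Lemma conn0l s x : sm s -> U x -> nab (fun=> 0) s x = 0.
Proof.
move=> ss Ux.
rewrite -[RHS](scale0r (nab (fun=> 0) s x)).
rewrite -[RHS](conn_scalel nabP (smoothC_cst U_open 0) (smooth_vfield_cst 0) ss Ux).
congr (nab _ s x).
by apply/funext => y; rewrite scaler0.
Qed.

(* Locality comes for free: the indicator function f of the complement of U is
   smooth on U, and a field Z vanishing on U equals f Z. *)
Lemma conn_local X Y s x : smooth_vfield U X -> smooth_vfield U Y -> sm s ->
  (forall y, U y -> X y = Y y) -> U x -> nab X s x = nab Y s x.
Proof.
move=> sX sY ss XY Ux; pose f y : R[i] := if `[< U y >] then 0 else 1.
have fU y : U y -> f y = 0 by move=> Uy; rewrite /f asboolT.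
have sf : smoothC U f.
  by apply: (smoothC_eq U_open _ (smoothC_cst U_open 0)) => y /fU.
have sZ := smooth_vfieldD sX (smooth_vfieldZ (smoothC_cst U_open (-1)) sY).
have -> : X = fun y => Y y + f y *: (X y + (-1) *: Y y).
  apply/funext => y; rewrite /f; case: asboolP => [/XY ->|_].
    by rewrite scale0r addr0.
  by rewrite scale1r scaleN1r addrC subrK.
rewrite (conn_addl nabP) //; last exact: smooth_vfieldZ.
by rewrite (conn_scalel nabP) // fU // scale0r addr0.
Qed.

(** Locality in the section, by the same indicator: s = f s everywhere, and the two Leibniz terms
    vanish because s x = 0 and f x = 0. *)
Lemma conn_zero X s x : smooth_vfield U X -> sm s ->
  (forall y, U y -> s y = 0) -> U x -> nab X s x = 0.
Proof.
move=> sX ss s0 Ux; pose f y : R[i] := if `[< U y >] then 0 else 1.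
have fU y : U y -> f y = 0 by move=> Uy; rewrite /f asboolT.
have sf : smoothC U f.
  by apply: (smoothC_eq U_open _ (smoothC_cst U_open 0)) => y /fU.
have {1}-> : s = fun y => f y *: s y.
  apply/funext => y; rewrite /f; case: asboolP => [/s0 ->|_].
    by rewrite scaler0.
  by rewrite scale1r.
by rewrite (conn_leibniz nabP) // s0 // fU // scaler0 scale0r addr0.
Qed.

Lemma conn_suml (I : Type) (t : seq I) (f : I -> 'rV[R]_m -> R[i])
    (X : I -> 'rV[R]_m -> 'rV[R[i]]_m) s x :
  (forall i, smoothC U (f i)) -> (forall i, smooth_vfield U (X i)) ->
  sm s -> U x ->
  nab (fun y => \sum_(i <- t) f i y *: X i y) s x =
  \sum_(i <- t) f i x *: nab (X i) s x.
Proof.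
move=> sf sX ss Ux; elim: t => [|i t IH].
  rewrite big_nil -[RHS](conn0l ss Ux); congr (nab _ s x).
  by apply/funext => y; rewrite big_nil.
rewrite big_cons -IH -(conn_scalel nabP (sf i) (sX i) ss Ux).
rewrite -(conn_addl nabP (smooth_vfieldZ (sf i) (sX i)) _ ss Ux).
  by congr (nab _ s x); apply/funext => y; rewrite big_cons.
exact: smooth_vfield_sum.
Qed.

End Connections.

(** * Pure spinors *)

Section SmoothSpinors.
Variables (R : realType) (n : nat) (U : set 'rV[R]_(n + n)).
Hypothesis U_open : open U.
Implicit Types (psi chi : 'rV[R]_(n + n) -> spinor R n).

Lemma smooth_sfield_eq psi chi : (forall y, U y -> psi y = chi y) ->
  smooth_sfield U psi -> smooth_sfield U chi.
Proof.
by move=> E spsi I; apply: (smoothC_eq U_open _ (spsi I)) => y /E ->.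
Qed.

Lemma smooth_sfieldD psi chi : smooth_sfield U psi -> smooth_sfield U chi ->
  smooth_sfield U (fun y => psi y + chi y).
Proof.
move=> spsi schi I.
apply: (smoothC_eq U_open _ (smoothCD U_open (spsi I) (schi I))) => y _.
by rewrite ffunE.
Qed.

Lemma smooth_sfieldZ f psi : smoothC U f -> smooth_sfield U psi ->
  smooth_sfield U (fun y => f y *: psi y).
Proof.
move=> sf spsi I.
apply: (smoothC_eq U_open _ (smoothCM U_open sf (spsi I))) => y _.
by rewrite ffunE.
Qed.

Lemma smooth_sfield_cst p : smooth_sfield U (fun=> p).
Proof. by move=> I; exact: smoothC_cst. Qed.

Lemma smooth_sfield_sum (I : Type) (t : seq I) (psi : I -> 'rV[R]_(n + n) -> spinor R n) :
  (forall i, smooth_sfield U (psi i)) ->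
  smooth_sfield U (fun y => \sum_(i <- t) psi i y).
Proof.
move=> spsi; elim: t => [|i t IH].
  by apply: smooth_sfield_eq (smooth_sfield_cst 0) => y _; rewrite big_nil.
apply: smooth_sfield_eq (smooth_sfieldD (spsi i) IH) => y _.
by rewrite big_cons.
Qed.

Lemma smooth_gamma a psi : smooth_sfield U psi ->
  smooth_sfield U (fun y => gamma a (psi y)).
Proof.
move=> spsi I; rewrite /gamma; case: (fintype.split a) => i.
  apply: (smoothC_eq U_open (u := fun y =>
    if i \in I then 0 else ext_sign R i I * psi y (i |: I))) => [y _|].
    by rewrite ffunE.
  case: (i \in I); first exact: smoothC_cst.
  by apply: smoothCM => //; exact: smoothC_cst.
apply: (smoothC_eq U_open (u := fun y =>
  if i \in I then ext_sign R i I * psi y (I :\ i) else 0)) => [y _|].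
  by rewrite ffunE.
case: (i \in I); last exact: smoothC_cst.
by apply: smoothCM => //; exact: smoothC_cst.
Qed.

End SmoothSpinors.

(** * The null distribution of a pure spinor *)

Section PureSpinorGeometry.
Variables (R : realType) (n : nat) (U : set 'rV[R]_(n + n)).
Variables (g : 'rV[R]_(n + n) -> 'M[R]_(n + n)).
Variable nabla : ('rV[R]_(n + n) -> 'rV[R[i]]_(n + n)) ->
  ('rV[R]_(n + n) -> 'rV[R[i]]_(n + n)) -> ('rV[R]_(n + n) -> 'rV[R[i]]_(n + n)).
Variables (e theta : 'I_n -> 'rV[R]_(n + n) -> 'rV[R[i]]_(n + n)).
Hypothesis U_open : open U.
Hypothesis g_metric : pseudo_riemannian U g.
Hypothesis nabla_lc : levi_civita U g nabla.
Hypothesis frameP : null_frame U g e theta.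

Local Notation clif := (clifford_mul e theta).
Local Notation fc := (frame_comp e theta).
Local Notation fr := (frame e theta).
Local Notation upper := (metric_upper g e theta).
Local Notation vf := ('rV[R]_(n + n) -> 'rV[R[i]]_(n + n)).
Local Notation sf := ('rV[R]_(n + n) -> spinor R n).
Implicit Types (X Y Z : vf) (psi : sf) (x : 'rV[R]_(n + n)).

Lemma smooth_frame a : smooth_vfield U (fr a).
Proof.
by case: frameP => s _ _ _; rewrite /frame; case: (fintype.split a) => i;
  case: (s i).
Qed.

Lemma smooth_frame_comp X a : smooth_vfield U X ->
  smoothC U (fun x => fc x (X x) 0 a).
Proof.
move=> sX; apply: smooth_mulmx => //; first exact/smooth_vfieldP.
apply: smooth_invmx => // [x Ux|b j]; first exact: (frame_mx_unit g_metric frameP).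
by apply: (smoothC_eq U_open _ (smooth_frame b j)) => y _; rewrite mxE.
Qed.

Lemma smooth_clifford X psi : smooth_vfield U X -> smooth_sfield U psi ->
  smooth_sfield U (fun x => clif x (X x) (psi x)).
Proof.
move=> sX spsi.
apply: (smooth_sfield_eq U_open (psi := fun x =>
  \sum_a fc x (X x) 0 a *: gamma a (psi x))) => [y _|].
  by rewrite cliffordE.
apply: smooth_sfield_sum => // a; apply: smooth_sfieldZ => //.
  exact: smooth_frame_comp.
exact: smooth_gamma.
Qed.

(** Tensoriality in X, needed for [nabla] and for spinorial connections alike. The frame expansion
    of X holds only on U, whence the appeal to locality. *)
Lemma conn_frame (E : lmodType R[i]) (sm : ('rV[R]_(n + n) -> E) -> Prop) nab X s x :
  is_connection U sm nab -> smooth_vfield U X -> sm s -> U x ->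
  nab X s x = \sum_a fc x (X x) 0 a *: nab (fr a) s x.
Proof.
move=> nabP sX ss Ux.
rewrite -(conn_suml U_open nabP (index_enum _) (f := fun a y => fc y (X y) 0 a)) //.
- apply: (conn_local U_open nabP) => //.
    by apply: smooth_vfield_sum => // a; [exact: smooth_frame_comp|exact: smooth_frame].
  by move=> y Uy; exact: (frame_expansion g_metric frameP).
- by move=> a; exact: smooth_frame_comp.
- exact: smooth_frame.
Qed.

Variable phi : sf.
Hypothesis phi_smooth : smooth_sfield U phi.
Hypothesis phi_pure : pure_spinor U e theta phi.

Definition null_distribution : Defs.distribution R (n + n) :=
  fun x => [set v | clif x v (phi x) = 0].
Local Notation N := null_distribution.

Lemma null_distributionE : N = annihilator e theta phi.
Proof. by rewrite /null_distribution clifford_mulE. Qed.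

Lemma pure_point x : U x -> phi x != 0 /\
  exists W : {vspace 'rV[R[i]]_(n + n)},
    \dim W = n /\ forall v, v \in W <-> clif x v (phi x) = 0.
Proof. by move=> Ux; have := phi_pure Ux; rewrite clifford_mulE. Qed.

(** The matrix of v -> v . phi(x), with spinor components enumerated as columns. Its left kernel is
    N, so sections of N become kernel vectors of a smooth matrix. *)
Definition annihilator_mx x : 'M[R[i]]_(n + n, #|{set 'I_n}|) :=
  \matrix_(a, k) clif x (delta_mx 0 a) (phi x) (enum_val k).

Lemma mul_annihilator_mx x v k :
  (v *m annihilator_mx x) 0 k = clif x v (phi x) (enum_val k).
Proof.
rewrite {2}(row_sum_delta v) clifford_suml mxE sum_ffunE.
by apply: eq_bigr => a _; rewrite !mxE ffunE.
Qed.

Lemma annihilator_mxP x v : N x v <-> v *m annihilator_mx x = 0.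
Proof.
split=> [Nv|v0].
  by apply/rowP => k; rewrite mul_annihilator_mx Nv ffunE mxE.
apply/ffunP => I; rewrite -[I]enum_rankK -mul_annihilator_mx v0 mxE.
by rewrite ffunE.
Qed.

Lemma smooth_annihilator_mx : smooth_mx U annihilator_mx.
Proof.
move=> a k; have sa := smooth_vfield_cst U_open (delta_mx 0 a).
apply: (smoothC_eq U_open _ (smooth_clifford sa phi_smooth (enum_val k))).
by move=> y _; rewrite mxE.
Qed.

(** The left kernel N takes n of the 2n dimensions. The rank being constant on U is what lets
    [kernel_section] stay in the kernel. *)
Lemma annihilator_mx_rank x : U x -> \rank (annihilator_mx x) = n.
Proof.
move=> Ux; have [_ pureW] := pure_point Ux.
have [B freeB BP] := annihilator_basis pureW.
have : \rank (kermx (annihilator_mx x)) = n.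
  rewrite -[RHS](eqP freeB); apply/eqmx_rank/andP; split.
    by apply/row_subP => i; apply/BP/annihilator_mxP/sub_kermxP; exact: row_sub.
  by apply/row_subP => i; apply/sub_kermxP/annihilator_mxP/BP; exact: row_sub.
rewrite mxrank_ker => rk.
have := rank_leq_row (annihilator_mx x) => /subnK; rewrite rk.
by move/eqP; rewrite eqn_add2l => /eqP.
Qed.

Lemma tangent_extension x v : U x -> N x v ->
  exists X, [/\ smooth_vfield U X, tangent_to U N X & X x = v].
Proof.
move=> Ux Nv; pose M := annihilator_mx.
(* B and C are one-sided inverses of the two factors of a rank factorization of M(x), which makes
   the minor B M(x) C the identity and the interpolating field equal to v at x. *)
have /row_fullP[B BM] : row_full (col_base (M x)) by exact: col_base_full.
have /row_freeP[C MC] : row_free (row_base (M x)) by exact: row_base_free.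
exists (fun y => kernel_section B C v (M y)); split.
- apply/smooth_vfieldP; rewrite /kernel_section.
  have sM := smooth_annihilator_mx.
  have sC (p q : nat) (A : 'M[R[i]]_(p, q)) := smooth_mx_cst U_open A.
  have sBMC : smooth_mx U (fun y => B *m M y *m C).
    by do 2!apply: smooth_mulmx => //.
  have sdet := smooth_det U_open sBMC.
  have sV : smooth_mx U (fun y => v *m M y *m C *m \adj (B *m M y *m C) *m B).
    apply: smooth_mulmx => //; apply: smooth_mulmx => //; last exact: smooth_adj.
    by do 2!apply: smooth_mulmx => //.
  move=> i j; apply: (smoothC_eq U_open (u := fun y => \det (B *m M y *m C) *
    (\det (B *m M y *m C) * v i j +
     - (v *m M y *m C *m \adj (B *m M y *m C) *m B) i j))) => [y _|].
    by rewrite !mxE.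
  apply: smoothCM => //; apply: smoothCD => //; last exact: smoothCN.
  by apply: smoothCM => //; exact: smoothC_cst.
- move=> y Uy; apply/annihilator_mxP; apply: kernel_sectionP.
  exact: (etrans (annihilator_mx_rank Uy) (esym (annihilator_mx_rank Ux))).
- apply: kernel_section_id; last exact/annihilator_mxP.
  rewrite -[RHS]mulmx1 -{1}BM -MC mulmxA -[B *m _ *m row_base _]mulmxA.
  by rewrite mulmx_base.
Qed.

Lemma spin_conn_zero nabS X psi x : is_connection U (@smooth_sfield R n U) nabS ->
  smooth_vfield U X -> (forall y, U y -> psi y = 0) -> U x -> nabS X psi x = 0.
Proof.
move=> nabP sX psi0 Ux; apply: (conn_zero U_open nabP) => //.
apply: (smooth_sfield_eq U_open _ (smooth_sfield_cst U_open 0)) => y Uy.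
by rewrite psi0.
Qed.

Lemma smooth_nabla X Y : smooth_vfield U X -> smooth_vfield U Y ->
  smooth_vfield U (nabla X Y).
Proof. by move=> sX sY; exact: (conn_smooth (lc_connection nabla_lc) sX sY). Qed.

(** Differentiates g(Y, Z) = 0, valid on U by isotropy. The direction X is arbitrary, so it may be a
    frame vector. *)
Lemma nabla_annihilator X Y Z x : smooth_vfield U X ->
  smooth_vfield U Y -> tangent_to U N Y -> smooth_vfield U Z -> tangent_to U N Z ->
  U x -> gC g x (nabla X Y x) (Z x) = - gC g x (nabla X Z x) (Y x).
Proof.
move=> sX sY tY sZ tZ Ux; apply/eqP; rewrite -addr_eq0; apply/eqP.
rewrite [X in _ + X](gC_sym g_metric) // -(lc_metric nabla_lc) //.
rewrite -[RHS](dirder_cst X 0 x); apply: (dirder_eq U_open) => // y Uy.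
have [phi0 _] := pure_point Uy.
exact: (annihilator_isotropic g_metric frameP Uy phi0 (tY y Uy) (tZ y Uy)).
Qed.

Lemma clifford_annihilator x u z : U x -> N x z ->
  clif x z (clif x u (phi x)) = (2 * gC g x u z) *: phi x.
Proof.
move=> Ux Nz; rewrite (gC_sym g_metric) // -(clifford_anticomm g_metric frameP) //.
by rewrite Nz clifford0r addr0.
Qed.

(** * The Dirac operator on a pure spinor *)

Section SpinorialConnection.
Variable nabS : vf -> sf -> sf.
Hypothesis nabSP : spinorial_connection U e theta nabla nabS.

(** The Leibniz rule applied to Y . phi, which vanishes on U. *)
Lemma spin_conn_annihilator X Y x :
  smooth_vfield U X -> smooth_vfield U Y -> tangent_to U N Y -> U x ->
  clif x (Y x) (nabS X phi x) = - clif x (nabla X Y x) (phi x).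
Proof.
move=> sX sY tY Ux; apply/eqP; rewrite -addr_eq0 addrC; apply/eqP.
rewrite clifford_mulE -(spin_clifford nabSP) // -clifford_mulE.
by apply: spin_conn_zero => //; case: nabSP.
Qed.

Lemma sum_upper (V : lmodType R[i]) x v (s : 'I_(n + n) -> V) : U x ->
  \sum_a \sum_b (upper x a b * gC g x v (fr a x)) *: s b =
  \sum_b fc x v 0 b *: s b.
Proof.
move=> Ux; rewrite exchange_big; apply: eq_bigr => b _ /=.
by rewrite -scaler_suml (frame_compE g_metric frameP).
Qed.

Lemma diracE x : Defs.dirac g e theta nabS phi x =
  \sum_a \sum_b upper x a b *: clif x (fr a x) (nabS (fr b) phi x).
Proof. by rewrite clifford_mulE. Qed.

Lemma twistorE X x : twistor g e theta nabS X phi x = nabS X phi x -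
  (2 * n)%N%:R^-1 *: clif x (X x) (Defs.dirac g e theta nabS phi x).
Proof. by rewrite clifford_mulE. Qed.

Lemma clifford_dirac X x : smooth_vfield U X -> tangent_to U N X -> U x ->
  clif x (X x) (Defs.dirac g e theta nabS phi x) = 2 *: nabS X phi x +
  \sum_a \sum_b upper x a b *:
    clif x (fr a x) (clif x (nabla (fr b) X x) (phi x)).
Proof.
move=> sX tX Ux.
(* The term 2 nab_X phi is expanded into a double sum with coefficients g^ab g(X, e_a), so that the
   identity can be checked for each pair a, b. *)
rewrite diracE (conn_frame (spin_connection nabSP) sX phi_smooth Ux).
rewrite -(sum_upper (X x) (fun b => nabS (fr b) phi x) Ux).
rewrite scaler_sumr -big_split clifford_sumr; apply: eq_bigr => a _ /=.
rewrite scaler_sumr -big_split clifford_sumr; apply: eq_bigr => b _ /=.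
rewrite cliffordZr.
have -> : clif x (X x) (clif x (fr a x) (nabS (fr b) phi x)) =
    (2 * gC g x (X x) (fr a x)) *: nabS (fr b) phi x +
    clif x (fr a x) (clif x (nabla (fr b) X x) (phi x)).
  rewrite -(clifford_anticomm g_metric frameP) //.
  have -> := spin_conn_annihilator (smooth_frame b) sX tX Ux.
  by rewrite cliffordNr addrNK.
exact: scale_combinationD.
Qed.

(** The metric dual of the 1-form Z -> g(nabla_Z X, Y). *)
Definition nabla_dual X Y x : 'rV[R[i]]_(n + n) :=
  \sum_a (\sum_b upper x a b * gC g x (nabla (fr b) X x) (Y x)) *: fr a x.

Lemma gC_nabla_dual X Y Z x : smooth_vfield U X -> smooth_vfield U Z -> U x ->
  gC g x (nabla_dual X Y x) (Z x) = gC g x (nabla Z X x) (Y x).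
Proof.
move=> sX sZ Ux; rewrite gC_suml.
rewrite (conn_frame (lc_connection nabla_lc) sZ sX Ux) gC_suml.
under eq_bigr do rewrite mulr_suml.
rewrite exchange_big; apply: eq_bigr => b _ /=.
rewrite (frame_compE g_metric frameP) // mulr_suml; apply: eq_bigr => a _.
by rewrite [gC g x (Z x) _](gC_sym g_metric) //; ring.
Qed.

(** Moving Y past e_a leaves 2 g(Y, e_a), which sums to nabla_Y X; moving it further past
    nabla_{e_b} X leaves the scalar 2 g(nabla_{e_b} X, Y), since Y kills phi, and this sums to the
    dual vector. *)
Lemma clifford_clifford_dirac X Y x :
  smooth_vfield U X -> tangent_to U N X ->
  smooth_vfield U Y -> tangent_to U N Y -> U x ->
  clif x (Y x) (clif x (X x) (Defs.dirac g e theta nabS phi x)) =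
  2 *: clif x (Y x) (nabS X phi x) + 2 *: clif x (nabla Y X x) (phi x) -
  2 *: clif x (nabla_dual X Y x) (phi x).
Proof.
move=> sX tX sY tY Ux; rewrite clifford_dirac // cliffordDr cliffordZr -addrA.
congr (_ + _); rewrite clifford_sumr.
rewrite (conn_frame (lc_connection nabla_lc) sY sX Ux) !clifford_suml.
rewrite -[X in 2 *: X - _](sum_upper (Y x)
  (fun b => clif x (nabla (fr b) X x) (phi x)) Ux).
rewrite sum_combination; apply: eq_bigr => a _.
rewrite clifford_sumr; apply: eq_bigr => b _.
rewrite cliffordZr.
have -> : clif x (Y x) (clif x (fr a x) (clif x (nabla (fr b) X x) (phi x))) =
    (2 * gC g x (Y x) (fr a x)) *: clif x (nabla (fr b) X x) (phi x) -
    (2 * gC g x (nabla (fr b) X x) (Y x)) *: clif x (fr a x) (phi x).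
  have annY := clifford_annihilator (nabla (fr b) X x) Ux (tY x Ux).
  rewrite -(clifford_anticomm g_metric frameP) //.
  by rewrite annY cliffordZr addrK.
exact: scale_combinationB.
Qed.

End SpinorialConnection.

Lemma gC_bracket X Y z x : smooth_vfield U X -> smooth_vfield U Y -> U x ->
  gC g x (bracket X Y x) z = gC g x (nabla X Y x) z - gC g x (nabla Y X x) z.
Proof. by move=> sX sY Ux; rewrite -(lc_torsion_free nabla_lc) // gCBl. Qed.

Lemma annihilator_orthogonal x v : U x ->
  (forall Z, smooth_vfield U Z -> tangent_to U N Z -> gC g x v (Z x) = 0) -> N x v.
Proof.
move=> Ux vN; have [phi0 pureW] := pure_point Ux.
apply: (annihilator_maximal g_metric frameP Ux phi0 pureW) => w Nw.
by have [Z [sZ tZ <-]] := tangent_extension Ux Nw; exact: vN.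
Qed.

Lemma twistor_cyclic nabS X Y Z x : (0 < n)%N ->
  spinorial_connection U e theta nabla nabS ->
  smooth_vfield U X -> tangent_to U N X ->
  smooth_vfield U Y -> tangent_to U N Y ->
  smooth_vfield U Z -> tangent_to U N Z -> U x ->
  twistor g e theta nabS X phi x = 0 ->
  n%:R * gC g x (nabla X Y x) (Z x) = gC g x (nabla X Y x) (Z x) -
    gC g x (nabla Y X x) (Z x) + gC g x (nabla Z X x) (Y x).
Proof.
move=> n0 nabSP sX tX sY tY sZ tZ Ux /eqP; rewrite twistorE subr_eq0 => /eqP twX.
have [phi0 _] := pure_point Ux; have tZx := tZ x Ux.
have Sphi : clif x (Z x) (clif x (Y x) (nabS X phi x)) =
    (- (2 * gC g x (nabla X Y x) (Z x))) *: phi x.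
  by rewrite (spin_conn_annihilator nabSP) // cliffordNr clifford_annihilator // scaleNr.
have twS : clif x (Z x) (clif x (Y x) (nabS X phi x)) = (2 * n)%N%:R^-1 *:
    (2 *: clif x (Z x) (clif x (Y x) (nabS X phi x)) +
     2 *: clif x (Z x) (clif x (nabla Y X x) (phi x)) -
     2 *: clif x (Z x) (clif x (nabla_dual X Y x) (phi x))).
  apply: (etrans (congr1 (fun s => clif x (Z x) (clif x (Y x) s)) twX)).
  rewrite cliffordZr (clifford_clifford_dirac nabSP sX tX sY tY Ux).
  exact: linear_combination.
rewrite Sphi (clifford_annihilator (nabla Y X x)) // in twS.
rewrite (clifford_annihilator (nabla_dual X Y x)) // gC_nabla_dual // in twS.
exact: (twistor_scalars n0 phi0 twS).
Qed.

Lemma twistor_integrable nabS : (0 < n)%N -> (2 * n)%N <> 6%N ->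
  spinorial_connection U e theta nabla nabS ->
  (forall X, smooth_vfield U X -> tangent_to U N X -> forall x, U x ->
     twistor g e theta nabS X phi x = 0) -> integrable_distribution U N.
Proof.
move=> n0 n3 nabSP tw X Y sX sY tX tY x Ux.
apply: annihilator_orthogonal => // Z sZ tZ; rewrite gC_bracket //.
have E1 := twistor_cyclic n0 nabSP sX tX sY tY sZ tZ Ux (tw X sX tX x Ux).
have E2 := twistor_cyclic n0 nabSP sY tY sX tX sZ tZ Ux (tw Y sY tY x Ux).
have E3 := twistor_cyclic n0 nabSP sZ tZ sX tX sY tY Ux (tw Z sZ tZ x Ux).
rewrite (nabla_annihilator sX sZ tZ sY tY) // in E3.
rewrite (nabla_annihilator sY sZ tZ sX tX) // in E3.
rewrite (nabla_annihilator sZ sY tY sX tX) // in E2.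
(* With a = T(X, Y, Z), b = T(Y, X, Z), c = T(Z, X, Y) the equations are n a = a - b + c, n b = b -
   a - c and n c = c + a - b. The first plus the second gives b = -a, the first minus the third
   gives c = a, and then n a = 3 a. The goal is a - b = 0. *)
move: (gC _ _ _ _) (gC _ _ _ _) (gC _ _ _ _) E1 E2 E3 => c b a E1 E2 E3.
have nR0 : n%:R != 0 :> R[i] by rewrite pnatr_eq0 -lt0n.
have nR3 : n%:R - 3 != 0 :> R[i].
  rewrite subr_eq0 eqr_nat; apply/eqP => n3'; apply: n3.
  by rewrite n3'.
have /eqP : n%:R * (a + b) = 0 by rewrite mulrDr E1 E2; ring.
rewrite mulf_eq0 (negPf nR0) /= addr_eq0 => /eqP ab.
have /eqP : n%:R * (a - c) = 0 by rewrite mulrBr E1 E3; ring.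
rewrite mulf_eq0 (negPf nR0) /= subr_eq0 => /eqP ac.
have /eqP : (n%:R - 3) * a = 0 by rewrite mulrBl E1 -ac -[b]opprK -ab; ring.
rewrite mulf_eq0 (negPf nR3) /= => /eqP a0.
by apply/eqP; rewrite subr_eq0 -[b]opprK -ab a0 oppr0.
Qed.

(** * The integrable case *)

Section Integrable.
Hypothesis N_integrable : integrable_distribution U N.

(** Integrability and vanishing torsion make T symmetric in its first two arguments, while metricity
    makes it antisymmetric in the last two; such a T is zero. *)
Lemma integrable_parallel X Y x :
  smooth_vfield U X -> tangent_to U N X -> smooth_vfield U Y -> tangent_to U N Y ->
  U x -> N x (nabla X Y x).
Proof.
have sym A B C : smooth_vfield U A -> tangent_to U N A ->
    smooth_vfield U B -> tangent_to U N B ->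
    smooth_vfield U C -> tangent_to U N C -> U x ->
    gC g x (nabla A B x) (C x) = gC g x (nabla B A x) (C x).
  move=> sA tA sB tB sC tC Ux; apply/eqP; rewrite -subr_eq0 -gC_bracket //.
  have [phi0 _] := pure_point Ux.
  apply/eqP/(annihilator_isotropic g_metric frameP Ux phi0); last exact: tC.
  exact: N_integrable.
move=> sX tX sY tY Ux; apply: annihilator_orthogonal => // Z sZ tZ.
(* Alternating the two symmetries three times returns to the same term with three sign changes. *)
have : gC g x (nabla X Y x) (Z x) = - gC g x (nabla X Y x) (Z x).
  rewrite {1}(sym X Y Z) // (nabla_annihilator sY sX tX sZ tZ Ux) (sym Y Z X) //.
  rewrite (nabla_annihilator sZ sY tY sX tX Ux) (sym Z X Y) //.
  rewrite (nabla_annihilator sX sZ tZ sY tY Ux); exact: opprK.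
move/eqP; rewrite -addr_eq0 -mulr2n -mulr_natl mulf_eq0 pnatr_eq0.
by move/eqP.
Qed.

(** For Y in N, the spinor Y . T_X phi is a combination of nabla_X Y, nabla_Y X and the dual vector,
    each applied to phi. The first two lie in N by parallelism; the third is orthogonal to N, hence
    lies in N as well. *)
Lemma integrable_twistor_line nabS X x :
  spinorial_connection U e theta nabla nabS ->
  smooth_vfield U X -> tangent_to U N X -> U x ->
  exists c, twistor g e theta nabS X phi x = c *: phi x.
Proof.
move=> nabSP sX tX Ux; have [phi0 pureW] := pure_point Ux.
apply: (pure_spinor_line g_metric frameP Ux phi0 pureW) => v Nv.
have [Y [sY tY <-]] := tangent_extension Ux Nv.
rewrite twistorE cliffordDr cliffordNr cliffordZr (clifford_clifford_dirac nabSP) //.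
rewrite (spin_conn_annihilator nabSP) // !integrable_parallel //.
rewrite (_ : clif x (nabla_dual X Y x) (phi x) = 0).
  by rewrite oppr0 !scaler0 subr0 addr0 scaler0 subr0.
apply: annihilator_orthogonal => // Z sZ tZ; rewrite gC_nabla_dual //.
have Nn := integrable_parallel sZ tZ sX tX Ux.
exact: (annihilator_isotropic g_metric frameP Ux phi0 Nn (tY x Ux)).
Qed.

End Integrable.

(** Here N is a line, spanned by X wherever X is nonzero. Metricity makes nabla_{e_b} X orthogonal
    to X, so it kills phi; then X . D phi = 2 nab_X phi, and the factor 2 cancels 1/(2n). Where X
    vanishes, tensoriality suffices. *)
Lemma surface_twistor nabS X x : n = 1%N ->
  spinorial_connection U e theta nabla nabS ->
  smooth_vfield U X -> tangent_to U N X -> U x ->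
  twistor g e theta nabS X phi x = 0.
Proof.
move=> n1 nabSP sX tX Ux.
have [Xx0|Xx0] := eqVneq (X x) 0.
  rewrite twistorE (conn_frame (spin_connection nabSP) sX phi_smooth Ux) Xx0.
  rewrite big1 => [|a _]; last by rewrite linear0 mxE scale0r.
  by rewrite -[X in clif _ X](scale0r 0) cliffordZl scale0r scaler0 subr0.
have Nnab b : clif x (nabla (fr b) X x) (phi x) = 0.
  apply: annihilator_orthogonal => // Z sZ tZ.
  have [_ [W [dimW WP]]] := pure_point Ux.
  have /eqP WX : (<[X x]> == W)%VS.
    rewrite eqEdim dimW dim_vline Xx0 -memvE; apply/andP; split.
      by apply/WP; exact: tX.
    by rewrite n1.
  have : Z x \in W by apply/WP; exact: tZ.
  rewrite -WX => /vlineP[c ->]; rewrite gCZr.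
  have /eqP := nabla_annihilator (smooth_frame b) sX tX sX tX Ux.
  rewrite -addr_eq0 -mulr2n -mulr_natl mulf_eq0 pnatr_eq0 /= => /eqP ->.
  by rewrite mulr0.
rewrite twistorE (clifford_dirac nabSP) //.
under eq_bigr do under eq_bigr do rewrite Nnab clifford0r scaler0.
rewrite big1 => [|a _]; last by rewrite big1.
rewrite addr0 scalerA.
have -> : (2 * n)%N%:R^-1 * 2 = 1 :> R[i] by rewrite n1 mulVf // pnatr_eq0.
by rewrite scale1r subrr.
Qed.

End PureSpinorGeometry.

(** * Spinorial connections *)

(** The origin of 1 - 1/n: a change of nab_X phi by a phi changes X . D phi by 2 a phi, which enters
    the twistor operator with weight 1/(2n). *)
Lemma twistor_combination (K : numFieldType) (V : lmodType K) n (a : K) (u v p : V) :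
  u + a *: p - (2 * n)%N%:R^-1 *: (v + (2 * a) *: p) =
  u - (2 * n)%N%:R^-1 *: v + (a * (1 - n%:R^-1)) *: p.
Proof.
have -> : a * (1 - n%:R^-1) = a - (2 * n)%N%:R^-1 * (2 * a).
  rewrite natrM invfM mulrAC [2^-1 * (2 * a)]mulrA mulVf ?pnatr_eq0 // mul1r.
  by rewrite mulrBr mulr1.
by rewrite scalerBl scalerDr scalerA opprD [RHS]addrACA.
Qed.

Lemma leibniz_combination (K : comNzRingType) (V : lmodType K) (k t : K) (d u v w : V) :
  d + t *: u + t *: v + k *: (t *: w) = d + t *: (u + v + k *: w).
Proof. by rewrite !scalerDr !scalerA !addrA (mulrC t). Qed.

Lemma sum_scaled_delta (K : comNzRingType) (I : finType) (i : I) (f : I -> K) :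
  \sum_j f j * (i == j)%:R = f i.
Proof.
rewrite (bigD1 i) //= eqxx mulr1 big1 ?addr0 // => j.
by rewrite eq_sym => /negPf ->; rewrite mulr0.
Qed.

(* Here p is 2 g and O a c is omega_{ea}^c for a fixed frame vector e_e, so that
   skew says that the connection is metric. *)
Lemma spin_commutator (K : numFieldType) (V : lmodType K) (I : finType)
    (gam : I -> {linear V -> V}) (p O : I -> I -> K) :
  (forall a b psi, gam a (gam b psi) + gam b (gam a psi) = p a b *: psi) ->
  (forall a b, p a b = p b a) ->
  (forall a c, \sum_b p a b * p b c = (a == c)%:R) ->
  (forall a b, \sum_c O a c * p c b + \sum_c O b c * p c a = 0) ->
  let Gamma psi := - (4^-1 *: \sum_d \sum_c
    (\sum_a 2 * p a d * O a c) *: gam d (gam c psi)) in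
  forall b psi, Gamma (gam b psi) - gam b (Gamma psi) = \sum_c O b c *: gam c psi.
Proof.
move=> anti p_sym p_inv skew /= b psi.
pose w d c := \sum_a 2 * p a d * O a c.
(* Contracting the second index of w needs [skew] to exchange a and b, hence the sign; contracting
   the first uses only that p is its own inverse. *)
have wl d : \sum_c w d c * p c b = - (2 * O b d).
  transitivity (\sum_a 2 * p a d * \sum_c O a c * p c b).
    under eq_bigr do rewrite mulr_suml.
    rewrite exchange_big; apply: eq_bigr => a _ /=.
    by rewrite mulr_sumr; apply: eq_bigr => c _; rewrite mulrA.
  transitivity (- (2 * \sum_c O b c * \sum_a p c a * p a d)).
    rewrite mulr_sumr -sumrN.
    under [RHS]eq_bigr do rewrite mulr_sumr mulr_sumr -sumrN.
    rewrite exchange_big; apply: eq_bigr => a _ /=.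
    move/eqP: (skew a b); rewrite addr_eq0 => /eqP ->.
    rewrite mulrN mulr_sumr -sumrN; apply: eq_bigr => c _.
    by congr (- _); ring.
  congr (- (2 * _)); rewrite -[RHS](sum_scaled_delta d (O b)).
  by apply: eq_bigr => c _; rewrite p_inv eq_sym.
have wr c : \sum_d w d c * p d b = 2 * O b c.
  transitivity (2 * \sum_a O a c * \sum_d p a d * p d b).
    rewrite mulr_sumr; under eq_bigr do rewrite mulr_suml.
    rewrite exchange_big; apply: eq_bigr => a _ /=.
    by rewrite !mulr_sumr; apply: eq_bigr => d _; ring.
  congr (2 * _); rewrite -[RHS](sum_scaled_delta b (O^~ c)).
  by apply: eq_bigr => a _; rewrite p_inv eq_sym.
(* Two applications of the Clifford relation carry gam b to the left through the product. *)
have comm d c : gam d (gam c (gam b psi)) - gam b (gam d (gam c psi)) =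
    p c b *: gam d psi - p d b *: gam c psi.
  have <- : gam d (p c b *: psi) = p c b *: gam d psi by rewrite linearZ.
  rewrite -(anti c b) -(anti d b) linearD opprD addrA.
  by rewrite addrK.
rewrite linearN opprK addrC linearZ -scalerBr linear_sum -sumrB.
transitivity (4^-1 *: \sum_d \sum_c w d c *: (p d b *: gam c psi - p c b *: gam d psi)).
  congr (_ *: _); apply: eq_bigr => d _; rewrite linear_sum -sumrB.
  apply: eq_bigr => c _; rewrite linearZ -scalerBr; congr (_ *: _).
  by rewrite -[LHS]opprB comm; exact: opprB.
transitivity (4^-1 *: (\sum_c (\sum_d w d c * p d b) *: gam c psi -
                       \sum_d (\sum_c w d c * p c b) *: gam d psi)).
  congr (_ *: _).
  under [X in _ = X - _]eq_bigr do rewrite scaler_suml.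
  rewrite [X in _ = X - _]exchange_big -sumrB; apply: eq_bigr => d _ /=.
  rewrite scaler_suml -sumrB; apply: eq_bigr => c _.
  by rewrite scalerBr !scalerA.
rewrite -sumrB scaler_sumr; apply: eq_bigr => c _.
(* The contractions contribute 2 + 2, which is the reason for the coefficient 1/4. *)
rewrite wr wl -scalerBl scalerA; by congr (_ *: _); field.
Qed.

(** * Construction of the spin connection in a null frame *)

Section SpinConnection.
Variables (R : realType) (n : nat) (U : set 'rV[R]_(n + n)).
Variables (g : 'rV[R]_(n + n) -> 'M[R]_(n + n)).
Variable nabla : ('rV[R]_(n + n) -> 'rV[R[i]]_(n + n)) ->
  ('rV[R]_(n + n) -> 'rV[R[i]]_(n + n)) -> ('rV[R]_(n + n) -> 'rV[R[i]]_(n + n)).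
Variables (e theta : 'I_n -> 'rV[R]_(n + n) -> 'rV[R[i]]_(n + n)).
Hypothesis U_open : open U.
Hypothesis g_metric : pseudo_riemannian U g.
Hypothesis nabla_lc : levi_civita U g nabla.
Hypothesis frameP : null_frame U g e theta.

Local Notation clif := (clifford_mul e theta).
Local Notation fc := (frame_comp e theta).
Local Notation fr := (frame e theta).
Local Notation upper := (metric_upper g e theta).
Local Notation vf := ('rV[R]_(n + n) -> 'rV[R[i]]_(n + n)).
Local Notation sf := ('rV[R]_(n + n) -> spinor R n).
Local Notation form := ('rV[R]_(n + n) -> 'cV[R[i]]_(n + n)).
Implicit Types (X Y Z : vf) (psi : sf) (x : 'rV[R]_(n + n)) (alpha : form).

Local Notation om := (omega e theta nabla).

(** Metricity on the frame: the functions g(e_b, e_c) are constant on U, so their derivatives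
    vanish. *)
Lemma omega_skew x a b c : U x ->
  \sum_d om x a b d * pairing R d c + \sum_d om x a c d * pairing R d b = 0.
Proof.
move=> Ux.
have half u v w : gC g x (nabla u v x) (fr w x) =
    2^-1 * \sum_d fc x (nabla u v x) 0 d * pairing R d w.
  rewrite [in LHS](frame_expansion g_metric frameP (nabla u v x) Ux) gC_suml.
  rewrite mulr_sumr; apply: eq_bigr => d _.
  by rewrite (gC_frame g_metric frameP) //; field.
have sfr := smooth_frame frameP.
have := lc_metric nabla_lc (sfr a) (sfr b) (sfr c) Ux.
rewrite [X in _ + X](gC_sym g_metric) // !half -mulrDr.
have -> : dirder (fr a) (fun y => gC g y (fr b y) (fr c y)) x = 0.
  rewrite -[RHS](dirder_cst (fr a) (pairing R b c / 2) x).
  by apply: (dirder_eq U_open) => // y Uy; rewrite (gC_frame g_metric frameP).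
by move/esym/eqP; rewrite mulf_eq0 invr_eq0 pnatr_eq0 /= => /eqP.
Qed.

Definition spin_coef x a (p : spinor R n) : spinor R n :=
  - (4^-1 *: \sum_d \sum_c omega_up g e theta nabla x a d c *: gamma d (gamma c p)).

Lemma spin_coef_is_linear x a : linear (spin_coef x a).
Proof.
move=> k p q; rewrite /spin_coef scalerN -opprD scalerA mulrC -scalerA -scalerDr.
congr (- (_ *: _)); rewrite scaler_sumr -big_split; apply: eq_bigr => d _ /=.
rewrite scaler_sumr -big_split; apply: eq_bigr => c _ /=.
have -> : gamma d (gamma c (k *: p + q)) =
    k *: gamma d (gamma c p) + gamma d (gamma c q) by rewrite 2!linearP.
by rewrite scalerDr !scalerA mulrC.
Qed.

HB.instance Definition _ x a := GRing.isLinear.Build _ _ _ _ (spin_coef x a)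
  (spin_coef_is_linear x a).

Lemma spin_coefD x a p q : spin_coef x a (p + q) = spin_coef x a p + spin_coef x a q.
Proof. exact: linearD. Qed.

Lemma spin_coefZ x a c p : spin_coef x a (c *: p) = c *: spin_coef x a p.
Proof. exact: linearZ. Qed.

(** The Leibniz rule in its essential case: the commutator of the spin coefficients with
    multiplication by e_b is multiplication by nabla_{e_a} e_b. *)
Lemma spin_coef_gamma x a b p : U x ->
  spin_coef x a (gamma b p) = gamma b (spin_coef x a p) +
    \sum_c om x a b c *: gamma c p.
Proof.
move=> Ux; apply/eqP; rewrite addrC -subr_eq; apply/eqP.
have E q : spin_coef x a q = - (4^-1 *: \sum_d \sum_c
    (\sum_b 2 * pairing R b d * om x a b c) *: gamma d (gamma c q)).
  congr (- (_ *: _)); apply: eq_bigr => d _; apply: eq_bigr => c _.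
  congr (_ *: _); apply: eq_bigr => b' _.
  by rewrite (metric_upperE g_metric frameP).
apply: (etrans (congr2 (fun s t => s - gamma b t) (E (gamma b p)) (E p))).
have skew b' c : \sum_d om x a b' d * pairing R d c +
    \sum_d om x a c d * pairing R d b' = 0 by exact: omega_skew.
pose gam d : {linear spinor R n -> spinor R n} := gamma d.
exact: (spin_commutator (gam := gam) (@gamma_anticomm R n) (@pairing_sym R n)
  (@pairing_involutive R n) skew b p).
Qed.

Definition sfield_dirder X psi x : spinor R n :=
  [ffun I => dirder X (fun y => psi y I) x].

Lemma sfield_dirder_eq X psi chi x : U x -> (forall y, U y -> psi y = chi y) ->
  sfield_dirder X psi x = sfield_dirder X chi x.
Proof.
move=> Ux E; apply/ffunP => I; rewrite !ffunE.
by apply: (dirder_eq U_open) => // y /E ->.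
Qed.

Lemma sfield_dirderD X psi chi x : smooth_sfield U psi -> smooth_sfield U chi ->
  U x -> sfield_dirder X (fun y => psi y + chi y) x =
         sfield_dirder X psi x + sfield_dirder X chi x.
Proof.
move=> spsi schi Ux; apply/ffunP => I; rewrite !ffunE.
rewrite -(dirderD X (spsi I) (schi I) Ux).
by apply: (dirder_eq U_open) => // y _; rewrite ffunE.
Qed.

Lemma sfield_dirderZ X f psi x : smoothC U f -> smooth_sfield U psi -> U x ->
  sfield_dirder X (fun y => f y *: psi y) x =
  dirder X f x *: psi x + f x *: sfield_dirder X psi x.
Proof.
move=> sf spsi Ux; apply/ffunP => I; rewrite !ffunE.
rewrite -[RHS](dirderM X sf (spsi I) Ux).
by apply: (dirder_eq U_open) => // y _; rewrite ffunE.
Qed.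

Lemma sfield_dirder_cst X p x : sfield_dirder X (fun=> p) x = 0.
Proof. by apply/ffunP => I; rewrite !ffunE dirder_cst. Qed.

Lemma sfield_dirder_sum X (I : Type) (t : seq I) (psi : I -> sf) x :
  (forall i, smooth_sfield U (psi i)) -> U x ->
  sfield_dirder X (fun y => \sum_(i <- t) psi i y) x =
  \sum_(i <- t) sfield_dirder X (psi i) x.
Proof.
move=> spsi Ux; elim: t => [|i t IH].
  rewrite big_nil -[RHS](sfield_dirder_cst X 0 x).
  by apply: sfield_dirder_eq => // y _; rewrite big_nil.
rewrite big_cons -IH -sfield_dirderD //; last exact: smooth_sfield_sum.
by apply: sfield_dirder_eq => // y _; rewrite big_cons.
Qed.

Lemma dirderMl X c f x : smoothC U f -> U x ->
  dirder X (fun y => c * f y) x = c * dirder X f x.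
Proof.
move=> sf Ux; rewrite (dirderM X (smoothC_cst U_open c) sf Ux).
by rewrite dirder_cst mul0r add0r.
Qed.

(** Frame vectors act on the spinor components with constant coefficients. *)
Lemma sfield_dirder_gamma X a psi x : smooth_sfield U psi -> U x ->
  sfield_dirder X (fun y => gamma a (psi y)) x = gamma a (sfield_dirder X psi x).
Proof.
move=> spsi Ux; apply/ffunP => I; rewrite /gamma.
case: (fintype.split a) => i; rewrite !ffunE.
  case: (boolP (i \in I)) => iI.
    rewrite -[RHS](dirder_cst X 0 x); apply: (dirder_eq U_open) => // y _.
    by rewrite ffunE iI.
  rewrite -dirderMl //; apply: (dirder_eq U_open) => // y _.
  by rewrite ffunE (negPf iI).
case: (boolP (i \in I)) => iI.
  rewrite -dirderMl //; apply: (dirder_eq U_open) => // y _.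
  by rewrite ffunE iI.
rewrite -[RHS](dirder_cst X 0 x); apply: (dirder_eq U_open) => // y _.
by rewrite ffunE (negPf iI).
Qed.

Definition spin_form x v p : spinor R n := \sum_a fc x v 0 a *: spin_coef x a p.

Lemma spin_formDl x u v p : spin_form x (u + v) p = spin_form x u p + spin_form x v p.
Proof.
rewrite /spin_form -big_split; apply: eq_bigr => a _ /=.
by rewrite linearD mxE scalerDl.
Qed.

Lemma spin_formZl x c v p : spin_form x (c *: v) p = c *: spin_form x v p.
Proof.
rewrite /spin_form scaler_sumr; apply: eq_bigr => a _.
by rewrite linearZ mxE scalerA.
Qed.

Lemma spin_formDr x v p q : spin_form x v (p + q) = spin_form x v p + spin_form x v q.
Proof.
rewrite /spin_form -big_split; apply: eq_bigr => a _ /=.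
by rewrite spin_coefD scalerDr.
Qed.

Lemma spin_formZr x v c p : spin_form x v (c *: p) = c *: spin_form x v p.
Proof.
rewrite /spin_form scaler_sumr; apply: eq_bigr => a _.
by rewrite spin_coefZ !scalerA mulrC.
Qed.

Lemma spin_form_frame x a p : U x -> spin_form x (fr a x) p = spin_coef x a p.
Proof.
move=> Ux; rewrite /spin_form (frame_comp_frame g_metric frameP) // (bigD1 a) //=.
rewrite mxE !eqxx scale1r big1 ?addr0 // => b /negPf ba.
by rewrite mxE ba andbF scale0r.
Qed.

Definition spin_conn alpha X psi x : spinor R n :=
  sfield_dirder X psi x + spin_form x (X x) (psi x) + form_app alpha x (X x) *: psi x.

Lemma form_appD alpha x u v :
  form_app alpha x (u + v) = form_app alpha x u + form_app alpha x v.
Proof. by rewrite /form_app mulmxDl mxE. Qed.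

Lemma form_appZ alpha x c v : form_app alpha x (c *: v) = c * form_app alpha x v.
Proof. by rewrite /form_app -scalemxAl mxE. Qed.

Lemma smooth_form_app alpha X : smooth_form U alpha -> smooth_vfield U X ->
  smoothC U (fun x => form_app alpha x (X x)).
Proof.
move=> sa sX; apply: smooth_mulmx => // i j; rewrite ord1; first exact: sX.
exact: sa.
Qed.

Lemma smooth_spin_conn alpha X psi : smooth_form U alpha -> smooth_vfield U X ->
  smooth_sfield U psi -> smooth_sfield U (spin_conn alpha X psi).
Proof.
move=> sa sX spsi.
have sfr := smooth_frame frameP.
have sfc Y b := smooth_frame_comp U_open g_metric frameP b (X := Y).
apply: smooth_sfieldD => //; last first.
  by apply: smooth_sfieldZ => //; exact: smooth_form_app.
apply: smooth_sfieldD => //.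
  move=> I; apply: (smoothC_eq U_open _ (smoothC_dirder U_open sX (spsi I))) => y _.
  by rewrite ffunE.
apply: smooth_sfield_sum => // a; apply: smooth_sfieldZ => //; first exact: sfc.
(* On U the inverse metric is the constant 2 * [pairing], so only the smoothness of omega is at
   stake. *)
apply: (smooth_sfield_eq U_open (psi := fun y => (- 4^-1) *: \sum_d \sum_c
    (\sum_b 2 * pairing R b d * om y a b c) *: gamma d (gamma c (psi y)))).
  move=> y Uy; rewrite scaleNr; congr (- (_ *: _)).
  apply: eq_bigr => d _; apply: eq_bigr => c _; congr (_ *: _).
  by apply: eq_bigr => b _; rewrite (metric_upperE g_metric frameP).
apply: smooth_sfieldZ => //; first exact: smoothC_cst.
apply: smooth_sfield_sum => // d; apply: smooth_sfield_sum => // c.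
apply: smooth_sfieldZ => //; last by do 2!apply: smooth_gamma => //.
apply: smoothC_sum => // b; apply: smoothCM => //; first exact: smoothC_cst.
exact: sfc (smooth_nabla nabla_lc (sfr a) (sfr b)).
Qed.

Lemma nabla_expansion X v x : smooth_vfield U X -> smooth_vfield U v -> U x ->
  nabla X v x = \sum_b (dirder X (fun y => fc y (v y) 0 b) x *: fr b x +
                        fc x (v x) 0 b *: nabla X (fr b) x).
Proof.
move=> sX sv Ux; have nabP := lc_connection nabla_lc.
have sfr := smooth_frame frameP.
have sfc b := smooth_frame_comp U_open g_metric frameP b sv.
have expand (t : seq 'I_(n + n)) :
    nabla X (fun y => \sum_(b <- t) fc y (v y) 0 b *: fr b y) x =
    \sum_(b <- t) (dirder X (fun y => fc y (v y) 0 b) x *: fr b x +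
                   fc x (v x) 0 b *: nabla X (fr b) x).
  elim: t => [|b t IH].
    rewrite big_nil; apply: (conn_zero U_open nabP) => // [|y _].
      apply: (smooth_vfield_eq U_open _ (smooth_vfield_cst U_open 0)) => y _.
      by rewrite big_nil.
    by rewrite big_nil.
  have sZ := smooth_vfieldZ U_open (sfc b) (sfr b).
  have sT : smooth_vfield U (fun y => \sum_(b <- t) fc y (v y) 0 b *: fr b y).
    exact: smooth_vfield_sum.
  rewrite big_cons -IH -(conn_leibniz nabP (sfc b) sX (sfr b) Ux).
  rewrite -(conn_addr nabP sX sZ sT Ux).
  by congr (nabla X _ x); apply/funext => y; rewrite big_cons.
rewrite -expand; set w := fun y => \sum_(b <- _) _.
have sw : smooth_vfield U w by exact: smooth_vfield_sum.
have sN := smooth_vfieldZ U_open (smoothC_cst U_open (-1)) sw.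
have sD := smooth_vfieldD U_open sv sN.
(* The field v agrees with its frame expansion w only on U; the difference vanishes there and
   contributes nothing by locality. *)
have -> : v = fun y => w y + (v y + -1 *: w y).
  by apply/funext => y; rewrite scaleN1r addrC subrK.
rewrite (conn_addr nabP sX sw sD Ux) (conn_zero U_open nabP sX sD _ Ux) ?addr0 //.
by move=> y Uy; rewrite scaleN1r {1}(frame_expansion g_metric frameP (v y) Uy) subrr.
Qed.

Lemma spin_conn_is_connection alpha : smooth_form U alpha ->
  is_connection U (@smooth_sfield R n U) (spin_conn alpha).
Proof.
move=> salpha; split.
- by move=> X psi; exact: smooth_spin_conn.
- move=> X Y psi sX sY spsi x Ux; rewrite /spin_conn form_appD spin_formDl.
  have -> : sfield_dirder (fun y => X y + Y y) psi x =
      sfield_dirder X psi x + sfield_dirder Y psi x.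
    by apply/ffunP => I; rewrite !ffunE dirder_addl.
  by rewrite scalerDl [RHS]addrACA; congr (_ + _); rewrite addrACA.
- move=> f X psi sf sX spsi x Ux; rewrite /spin_conn form_appZ spin_formZl.
  have -> : sfield_dirder (fun y => f y *: X y) psi x = f x *: sfield_dirder X psi x.
    by apply/ffunP => I; rewrite !ffunE dirder_scalel.
  by rewrite -scalerA -!scalerDr.
- move=> X psi chi sX spsi schi x Ux; rewrite /spin_conn spin_formDr.
  rewrite sfield_dirderD // scalerDr [RHS]addrACA; congr (_ + _).
  by rewrite addrACA.
- move=> f X psi sf sX spsi x Ux; rewrite /spin_conn spin_formZr.
  rewrite (sfield_dirderZ X sf spsi Ux).
  exact: leibniz_combination.
Qed.

Lemma sfield_dirder_clifford X v psi x :
  smooth_vfield U v -> smooth_sfield U psi -> U x ->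
  sfield_dirder X (fun y => clif y (v y) (psi y)) x =
  \sum_b dirder X (fun y => fc y (v y) 0 b) x *: gamma b (psi x) +
  clif x (v x) (sfield_dirder X psi x).
Proof.
move=> sv spsi Ux; have sfc b := smooth_frame_comp U_open g_metric frameP b sv.
have sg b : smooth_sfield U (fun y => gamma b (psi y)) by exact: smooth_gamma.
rewrite (sfield_dirder_eq X (chi := fun y =>
  \sum_b fc y (v y) 0 b *: gamma b (psi y)) Ux) => [|y _]; last by rewrite cliffordE.
rewrite sfield_dirder_sum //; last by move=> b; exact: smooth_sfieldZ.
rewrite cliffordE -big_split; apply: eq_bigr => b _ /=.
by rewrite sfield_dirderZ // sfield_dirder_gamma.
Qed.

Lemma spin_coef_clifford x a v p : U x ->
  spin_coef x a (clif x v p) = clif x v (spin_coef x a p) +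
    \sum_b fc x v 0 b *: clif x (nabla (fr a) (fr b) x) p.
Proof.
move=> Ux; rewrite !cliffordE linear_sum -big_split; apply: eq_bigr => b _ /=.
by rewrite spin_coefZ spin_coef_gamma // scalerDr cliffordE.
Qed.

Lemma clifford_nabla X v p x : smooth_vfield U X -> smooth_vfield U v -> U x ->
  clif x (nabla X v x) p =
  \sum_b dirder X (fun y => fc y (v y) 0 b) x *: gamma b p +
  \sum_a fc x (X x) 0 a *:
    \sum_b fc x (v x) 0 b *: clif x (nabla (fr a) (fr b) x) p.
Proof.
move=> sX sv Ux; rewrite nabla_expansion // big_split cliffordDl !clifford_suml.
congr (_ + _).
  by apply: eq_bigr => b _; rewrite (clifford_frame g_metric frameP).
under [RHS]eq_bigr do rewrite scaler_sumr.
rewrite exchange_big; apply: eq_bigr => b _ /=.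
have sfr := smooth_frame frameP.
rewrite (conn_frame U_open g_metric frameP (lc_connection nabla_lc) sX (sfr b) Ux).
rewrite clifford_suml scaler_sumr; apply: eq_bigr => a _.
by rewrite !scalerA mulrC.
Qed.

(** Differentiation yields the derivatives of the components of v, and the commutator of the spin
    form with v yields the terms in nabla of the frame; together they make up (nabla_X v) . psi. The
    potential is a scalar and commutes with v. *)
Lemma spin_conn_spinorial alpha : smooth_form U alpha ->
  spinorial_connection U e theta nabla (spin_conn alpha).
Proof.
move=> salpha; split; first exact: spin_conn_is_connection.
move=> X v psi sX sv spsi x Ux; rewrite -clifford_mulE /spin_conn.
rewrite sfield_dirder_clifford // clifford_nabla // !cliffordDr cliffordZr.
rewrite !addrA; congr (_ + _); rewrite -!addrA; congr (_ + _).
rewrite [RHS]addrC -addrA; congr (_ + _); rewrite /spin_form clifford_sumr -big_split.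
apply: eq_bigr => a _ /=.
by rewrite spin_coef_clifford // scalerDr cliffordZr.
Qed.

Lemma spin_conn_has_potential alpha :
  has_potential U g e theta nabla (spin_conn alpha) alpha.
Proof.
move=> a I x Ux; rewrite /spin_conn sfield_dirder_cst spin_form_frame // add0r.
have gammaE : \sum_d \sum_c omega_up g e theta nabla x a d c *:
      gamma d (gamma c (spinor_basis R I)) =
    \sum_d \sum_c omega_up g e theta nabla x a d c *:
      clifford e theta x (fr d x) (clifford e theta x (fr c x) (spinor_basis R I)).
  apply: eq_bigr => d _; apply: eq_bigr => c _.
  by rewrite -clifford_mulE !(clifford_frame g_metric frameP).
exact: (congr1 (fun s => - (4^-1 *: s) +
  form_app alpha x (fr a x) *: spinor_basis R I) gammaE).
Qed.

(** * Choice of the 1-form *)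

Variable phi : sf.
Hypothesis phi_smooth : smooth_sfield U phi.
Hypothesis phi_pure : pure_spinor U e theta phi.
Local Notation N := (null_distribution e theta phi).

Lemma form_app_sum (I : finType) alpha x (c : I -> R[i]) (v : I -> 'rV_(n + n)) :
  form_app alpha x (\sum_i c i *: v i) = \sum_i c i * form_app alpha x (v i).
Proof.
elim/big_rec2: _ => [|i y z _ <-]; first by rewrite /form_app mul0mx mxE.
by rewrite form_appD form_appZ.
Qed.

Local Notation spin0 := (spin_conn (fun=> 0)).

Lemma spin_conn_split alpha X x :
  spin_conn alpha X phi x = spin0 X phi x + form_app alpha x (X x) *: phi x.
Proof.
rewrite /spin_conn.
have -> : form_app (fun=> 0) x (X x) = 0 by rewrite /form_app mulmx0 mxE.
by rewrite scale0r addr0.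
Qed.

(** The shift adds to D phi the metric dual of beta, applied to phi. Since X kills phi, the Clifford
    relation turns its product with X into 2 beta(X) phi. *)
Lemma clifford_dirac_shift nabS nabS' (beta : 'I_(n + n) -> R[i]) X x :
  N x (X x) -> U x ->
  (forall b, nabS (fr b) phi x = nabS' (fr b) phi x + beta b *: phi x) ->
  clif x (X x) (Defs.dirac g e theta nabS phi x) =
  clif x (X x) (Defs.dirac g e theta nabS' phi x) +
  (2 * \sum_b fc x (X x) 0 b * beta b) *: phi x.
Proof.
move=> NX Ux shift.
have -> : Defs.dirac g e theta nabS phi x = Defs.dirac g e theta nabS' phi x +
    \sum_a \sum_b upper x a b *: clif x (fr a x) (beta b *: phi x).
  rewrite (diracE _ _ _ _ nabS) (diracE _ _ _ _ nabS').
  rewrite -big_split; apply: eq_bigr => a _ /=.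
  rewrite -big_split; apply: eq_bigr => b _ /=.
  by rewrite shift cliffordDr scalerDr.
rewrite cliffordDr; congr (_ + _).
transitivity (\sum_a \sum_b (upper x a b * gC g x (X x) (fr a x)) *:
    ((2 * beta b) *: phi x)).
  rewrite clifford_sumr; apply: eq_bigr => a _.
  rewrite clifford_sumr; apply: eq_bigr => b _; rewrite !cliffordZr.
  have := clifford_anticomm g_metric frameP (X x) (fr a x) (phi x) Ux.
  rewrite NX clifford0r addr0 => ->.
  by rewrite !scalerA; congr (_ *: _); ring.
rewrite (sum_upper g_metric frameP (X x) (fun b => (2 * beta b) *: phi x) Ux).
rewrite mulr_sumr scaler_suml; apply: eq_bigr => b _.
by rewrite scalerA mulrCA.
Qed.

Lemma twistor_shift nabS nabS' (beta : 'I_(n + n) -> R[i]) X x :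
  N x (X x) -> U x ->
  (forall b, nabS (fr b) phi x = nabS' (fr b) phi x + beta b *: phi x) ->
  nabS X phi x = nabS' X phi x + (\sum_b fc x (X x) 0 b * beta b) *: phi x ->
  twistor g e theta nabS X phi x = twistor g e theta nabS' X phi x +
  ((\sum_b fc x (X x) 0 b * beta b) * (1 - n%:R^-1)) *: phi x.
Proof.
move=> NX Ux shift shiftX; have diracX := clifford_dirac_shift NX Ux shift.
apply: (etrans (twistorE _ _ _ _ nabS _ _)).
apply: (etrans (congr2 (fun s t => s - (2 * n)%N%:R^-1 *: t) shiftX diracX)).
apply: (etrans (twistor_combination _ _ _ _ _)).
exact: (congr1 (fun s => s + _) (esym (twistorE _ _ _ _ nabS' _ _))).
Qed.

Lemma twistor_split alpha X x : N x (X x) -> U x ->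
  twistor g e theta (spin_conn alpha) X phi x = twistor g e theta spin0 X phi x +
  (form_app alpha x (X x) * (1 - n%:R^-1)) *: phi x.
Proof.
move=> NX Ux.
have formE : form_app alpha x (X x) =
    \sum_b fc x (X x) 0 b * form_app alpha x (fr b x).
  by rewrite {1}(frame_expansion g_metric frameP (X x) Ux) form_app_sum.
have shiftX := etrans (spin_conn_split alpha X x)
  (congr1 (fun s => spin0 X phi x + s *: phi x) formE).
rewrite formE.
exact: (twistor_shift NX Ux (fun b => spin_conn_split alpha (fr b) x) shiftX).
Qed.

Lemma smooth_form0 : smooth_form U (fun=> 0 : 'cV[R[i]]_(n + n)).
Proof. by move=> j; apply: smoothC_cst. Qed.

Lemma smooth_twistor X : smooth_vfield U X ->
  smooth_sfield U (twistor g e theta spin0 X phi).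
Proof.
move=> sX; have sfr := smooth_frame frameP.
have sclif := smooth_clifford U_open g_metric frameP.
have snab Y (sY : smooth_vfield U Y) := smooth_spin_conn smooth_form0 sY phi_smooth.
have sD : smooth_sfield U (Defs.dirac g e theta spin0 phi).
  apply: (smooth_sfield_eq U_open (psi := fun x => \sum_a \sum_b
    (2 * pairing R a b) *: clif x (fr a x) (spin0 (fr b) phi x))) => [y Uy|].
    rewrite diracE; apply: eq_bigr => a _; apply: eq_bigr => b _.
    by rewrite (metric_upperE g_metric frameP).
  apply: smooth_sfield_sum => // a; apply: smooth_sfield_sum => // b.
  apply: smooth_sfieldZ => //; first exact: smoothC_cst.
  by apply: sclif; [exact: sfr|exact: snab].
apply: (smooth_sfield_eq U_open (psi := fun x => spin0 X phi x + (- (2 * n)%N%:R^-1) *: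
    clif x (X x) (Defs.dirac g e theta spin0 phi x))) => [y _|].
  by rewrite twistorE scaleNr.
apply: smooth_sfieldD => //; first exact: snab.
by apply: smooth_sfieldZ => //; [exact: smoothC_cst|exact: sclif].
Qed.

(** X -> T_X phi is a spinor-valued 1-form, hence determined by the coordinate fields, although
    these are in general not tangent to N. *)
Lemma twistor_coord X x : smooth_vfield U X -> U x ->
  twistor g e theta spin0 X phi x =
  \sum_j X x 0 j *: twistor g e theta spin0 (fun=> delta_mx 0 j) phi x.
Proof.
move=> sX Ux; have nabP := spin_conn_is_connection smooth_form0.
have scst j := smooth_vfield_cst U_open (delta_mx 0 j : 'rV[R[i]]_(n + n)).
under eq_bigr do rewrite twistorE scalerBr.
rewrite sumrB twistorE; congr (_ - _).
  have XE : X = fun y => \sum_j X y 0 j *: delta_mx 0 j.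
    by apply/funext => y; exact: row_sum_delta.
  apply: (etrans (congr1 (fun Y => spin0 Y phi x) XE)).
  exact: (conn_suml U_open nabP (index_enum _) (f := fun j y => X y 0 j)
    (X := fun j _ => delta_mx 0 j) sX scst phi_smooth Ux).
rewrite {1}(row_sum_delta (X x)) clifford_suml scaler_sumr.
by apply: eq_bigr => j _; rewrite !scalerA mulrC.
Qed.

(** The conjugation ensures that the product of a nonzero spinor with itself is nonzero, so that one
    may divide by it; a bilinear sum of squares could vanish. *)
Definition sinner (p q : spinor R n) : R[i] := \sum_I p I * (q I)^*%C.

Lemma sinnerZ c p q : sinner (c *: p) q = c * sinner p q.
Proof.
rewrite /sinner mulr_sumr; apply: eq_bigr => I _.
by rewrite ffunE mulrA.
Qed.

Lemma sinner_sum (J : finType) (c : J -> R[i]) (p : J -> spinor R n) q :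
  sinner (\sum_j c j *: p j) q = \sum_j c j * sinner (p j) q.
Proof.
rewrite /sinner; under [RHS]eq_bigr do rewrite mulr_sumr.
rewrite exchange_big; apply: eq_bigr => I _ /=.
rewrite sum_ffunE mulr_suml; apply: eq_bigr => j _.
by rewrite ffunE mulrA.
Qed.

Lemma sinner_neq0 p : p != 0 -> sinner p p != 0.
Proof.
apply: contra_neq => p0; apply/ffunP => I; rewrite ffunE; apply/eqP.
have ge0 J : true -> 0 <= p J * (p J)^*%C by move=> _; exact: mul_conjC_ge0.
move/eqP: p0; rewrite /sinner psumr_eq0 // => /allP /(_ I).
by rewrite mem_index_enum => /(_ isT); rewrite mul_conjC_eq0.
Qed.

Lemma smooth_sinner psi chi : smooth_sfield U psi -> smooth_sfield U chi ->
  smoothC U (fun x => sinner (psi x) (chi x)).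
Proof.
move=> spsi schi; apply: smoothC_sum => // I.
by apply: smoothCM => //; exact: smoothC_conj.
Qed.

(* Changing A by alpha adds (1 - 1/n) alpha(X) phi to T_X phi for X in N, so alpha
   must be - n / (n - 1) times the coefficient of T_X phi along phi.  The latter,
   read off with a Hermitian product, makes sense for all X.  For n = 1 the junk
   value n / 0 = 0 is harmless, as T_X phi already vanishes. *)
Definition twistor_potential : form := fun x => \col_j (- (n%:R / (n%:R - 1)) *
  (sinner (twistor g e theta spin0 (fun=> delta_mx 0 j) phi x) (phi x) /
   sinner (phi x) (phi x))).

Lemma smooth_twistor_potential : smooth_form U twistor_potential.
Proof.
move=> j; apply: (smoothC_eq U_open (u := fun x => - (n%:R / (n%:R - 1)) *
  (sinner (twistor g e theta spin0 (fun=> delta_mx 0 j) phi x) (phi x) /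
   sinner (phi x) (phi x)))) => [x _|]; first by rewrite mxE.
apply: smoothCM => //; first exact: smoothC_cst.
apply: smoothCM => //.
  apply: smooth_sinner => //; apply: smooth_twistor; exact: smooth_vfield_cst.
apply: smoothCV => //; last exact: smooth_sinner.
by move=> x Ux; apply: sinner_neq0; have [] := phi_pure Ux.
Qed.

Lemma twistor_potentialE X x c : smooth_vfield U X -> U x ->
  twistor g e theta spin0 X phi x = c *: phi x ->
  form_app twistor_potential x (X x) = - (n%:R / (n%:R - 1)) * c.
Proof.
move=> sX Ux twX; have [phi0 _] := phi_pure Ux.
have inner0 := sinner_neq0 phi0.
have -> : c = sinner (c *: phi x) (phi x) / sinner (phi x) (phi x).
  by rewrite sinnerZ mulfK.
rewrite -twX twistor_coord // sinner_sum /form_app mxE mulr_suml mulr_sumr.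
by apply: eq_bigr => j _; rewrite mxE mulrCA -mulrA.
Qed.

Lemma twistor_potential_vanishes X x : (0 < n)%N -> integrable_distribution U N ->
  smooth_vfield U X -> tangent_to U N X -> U x ->
  twistor g e theta (spin_conn twistor_potential) X phi x = 0.
Proof.
move=> n0 intN sX tX Ux.
have spinP := spin_conn_spinorial smooth_twistor_potential.
have [n1|n1] := eqVneq n 1%N.
  exact: (surface_twistor U_open g_metric nabla_lc frameP phi_smooth phi_pure n1).
have spin0P := spin_conn_spinorial smooth_form0.
have [c twX] := integrable_twistor_line U_open g_metric nabla_lc frameP
  phi_smooth phi_pure intN spin0P sX tX Ux.
rewrite twistor_split //; last exact: tX.
rewrite (twistor_potentialE sX Ux twX) twX -scalerDl.
have nR0 : n%:R != 0 :> R[i] by rewrite pnatr_eq0 -lt0n.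
have nR1 : n%:R - 1 != 0 :> R[i] by rewrite subr_eq0 (eqr_nat _ n 1).
apply: (etrans (congr1 (fun s => s *: phi x) _) (scale0r _)).
by field; rewrite nR0 nR1.
Qed.

End SpinConnection.

Theorem theorem4 (R : realType) (n : nat) (n_gt0 : (0 < n)%N)
    (U : set (coords R (n + n))) (U_open : open U)
    (g : metric_field R (n + n)) (g_metric : pseudo_riemannian U g)
    (nabla : vfield R (n + n) -> vfield R (n + n) -> vfield R (n + n))
    (nabla_lc : levi_civita U g nabla)
    (e theta : 'I_n -> vfield R (n + n)) (frameP : null_frame U g e theta)
    (phi : sfield R n) (phi_smooth : smooth_sfield U phi)
    (phi_pure : pure_spinor U e theta phi) :
  (integrable_distribution U (annihilator e theta phi) ->
   exists (A : coords R (n + n) -> 'cV[R[i]]_(n + n))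
          (nabS : vfield R (n + n) -> sfield R n -> sfield R n),
     [/\ smooth_form U A,
         spinorial_connection U e theta nabla nabS,
         has_potential U g e theta nabla nabS A
       & twistor_vanishes U g e theta nabS phi]) /\
  ((2 * n)%N <> 6%N ->
   forall nabS : vfield R (n + n) -> sfield R n -> sfield R n,
     spinorial_connection U e theta nabla nabS ->
     twistor_vanishes U g e theta nabS phi ->
     integrable_distribution U (annihilator e theta phi)).
Proof.
rewrite /twistor_vanishes -null_distributionE; split=> [intN|n3 nabS nabSP tw].
  exists (twistor_potential g nabla e theta phi).
  exists (spin_conn g nabla e theta (twistor_potential g nabla e theta phi)).
  have sA := smooth_twistor_potential U_open g_metric nabla_lc frameP
    phi_smooth phi_pure.
  split; first exact: sA.
  - exact: spin_conn_spinorial.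
  - exact: spin_conn_has_potential.
  - move=> X sX tX x Ux.
    exact: (twistor_potential_vanishes U_open g_metric nabla_lc frameP
      phi_smooth phi_pure n_gt0 intN sX tX Ux).
exact: (twistor_integrable U_open g_metric nabla_lc frameP phi_smooth phi_pure
  n_gt0 n3 nabSP tw).
Qed.
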